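(* Let $d\ge2$ and let $Y_1,\ldots,Y_n$ be random vectors in $\mathbb{R}^d$ that are symmetrically exchangeable and almost surely in type $B$ general position. Let $$\mathcal{G}_n^B:=\{v\in\mathbb{R}^d:\langle v,Y_1\rangle\le\cdots\le\langle v,Y_n\rangle\le0\}.$$ Then the Weyl random cone $\mathcal{D}_n^B$ of type $B_n$ has the same distribution as $\mathcal{G}_n^B$ conditioned on the event $\mathcal{G}_n^B\ne\{0\}$, while the dual Weyl cone $\mathcal{C}_n^B$ of type $B_n$ has the same distribution as the dual cone $(\mathcal{D}_n^B)^\circ$.
   Context: Type $B$ general position: vectors $y_1,\ldots,y_n\in\mathbb{R}^d$ are said to be in type $B$ general position if $n\ge d$ and, for every $\varepsilon=(\varepsilon_1,\ldots,\varepsilon_n)\in\{\pm1\}^n$ and every permutation $\sigma$ of $\{1,\ldots,n\}$, any $d$ of the vectors $\varepsilon_1y_{\sigma(1)}-\varepsilon_2y_{\sigma(2)},\ldots,\varepsilon_{n-1}y_{\sigma(n-1)}-\varepsilon_ny_{\sigma(n)},\,\varepsilon_ny_{\sigma(n)}$ are linearly independent. Symmetrically exchangeable means that $(Y_1,\ldots,Y_n)$ has the same distribution as $(\varepsilon_1Y_{\sigma(1)},\ldots,\varepsilon_nY_{\sigma(n)})$ for every permutation $\sigma$ of $\{1,\ldots,n\}$ and every $\varepsilon\in\{\pm1\}^n$. For $x\in\mathbb{R}^d\setminus\{0\}$ let $x^\perp=\{v\in\mathbb{R}^d:\langle v,x\rangle=0\}$. The Weyl tessellation $\mathcal{W}^B(y_1,\ldots,y_n)$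 of type $B_n$ is the set of cones obtained as closures of the connected components of the complement in $\mathbb{R}^d$ of the union of the hyperplanes $(y_i+y_j)^\perp$ and $(y_i-y_j)^\perp$ for $1\le i<j\le n$, and $y_i^\perp$ for $1\le i\le n$. The Weyl random cone $\mathcal{D}_n^B$ is obtained by choosing uniformly at random one of the cones of the random tessellation $\mathcal{W}^B(Y_1,\ldots,Y_n)$; that is, for a Borel set $\mathcal{B}$ of polyhedral cones, $\mathbb{P}(\mathcal{D}_n^B\in\mathcal{B})=\mathbb{E}\big[\frac{1}{\#\mathcal{W}^B(Y_1,\ldots,Y_n)}\sum_{C\in\mathcal{W}^B(Y_1,\ldots,Y_n)}\mathbf{1}_{\mathcal{B}}(C)\big]$. $\operatorname{pos}\{x_1,\ldots,x_m\}=\{\sum_i\lambda_ix_i:\lambda_i\ge0\}$. The dual Weyl cone $\mathcal{C}_n^B$ is the random cone whose distribution is that of $\operatorname{pos}\{Y_1-Y_2,\ldots,Y_{n-1}-Y_n,Y_n\}$ conditioned on the event that this positive hull is not equal to $\mathbb{R}^d$. The dual of a cone $C\subset\mathbb{R}^d$ is $C^\circ=\{v\in\mathbb{R}^d:\langle x,v\rangle\le0\text{ for all }x\in C\}$. *)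

(* Defs.v *)
From HB Require Import structures.
From mathcomp Require Import all_boot all_order all_algebra all_fingroup finmap.
From mathcomp Require Import all_classical all_reals all_analysis.

Set Implicit Arguments.
Unset Strict Implicit.
Unset Printing Implicit Defensive.

Import Order.TTheory GRing.Theory Num.Theory.
Import numFieldNormedType.Exports.

Local Open Scope classical_set_scope.
Local Open Scope ring_scope.

Definition dot (R : realType) (d : nat) (u v : 'rV[R]_d) : R :=
  \sum_(k < d) u 0 k * v 0 k.

Definition orthogonal_hyperplane (R : realType) (d : nat) (x : 'rV[R]_d) :
    set 'rV[R]_d :=
  [set v | dot v x = 0].

Definition pos_hull (R : realType) (d m : nat) (x : 'I_m -> 'rV[R]_d) :
    set 'rV[R]_d :=
  [set v | exists2 l : 'I_m -> R,
     forall i, 0 <= l i & v = \sum_(i < m) l i *: x i].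

Definition dual_cone (R : realType) (d : nat) (C : set 'rV[R]_d) :
    set 'rV[R]_d :=
  [set v | forall x, C x -> dot x v <= 0].

Definition polyhedral_cone (R : realType) (d : nat) (C : set 'rV[R]_d) : Prop :=
  exists (m : nat) (a : 'I_m -> 'rV[R]_d),
    C = [set v | forall i, dot v (a i) <= 0].

(* The sign eps_i in {1, -1} is encoded as (-1) ^+ eps i with eps i : bool. *)
Definition signed_permutation (R : realType) (d n : nat) (eps : 'I_n -> bool)
    (s : 'S_n) (y : 'I_n -> 'rV[R]_d) : 'I_n -> 'rV[R]_d :=
  fun i => (-1) ^+ eps i *: y (s i).

(* z_1 - z_2, ..., z_(n-1) - z_n, z_n; [insub i.+1] is [None] exactly at the
   last index. *)
Definition successive_differences (R : realType) (d n : nat)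
    (z : 'I_n -> 'rV[R]_d) : 'I_n -> 'rV[R]_d :=
  fun i => if insub i.+1 is Some j then z i - z j else z i.

Definition typeB_general_position (R : realType) (d n : nat)
    (y : 'I_n -> 'rV[R]_d) : Prop :=
  (d <= n)%N /\
  forall (eps : 'I_n -> bool) (s : 'S_n) (f : 'I_d -> 'I_n), injective f ->
    row_free (\matrix_(k < d)
      successive_differences (signed_permutation eps s y) (f k)).

Definition typeB_arrangement (R : realType) (d n : nat)
    (y : 'I_n -> 'rV[R]_d) : set 'rV[R]_d :=
  \bigcup_(p in [set p : 'I_n * 'I_n | (p.1 < p.2)%N])
    (orthogonal_hyperplane (y p.1 + y p.2) `|`
     orthogonal_hyperplane (y p.1 - y p.2))
  `|` \bigcup_(i in [set: 'I_n]) orthogonal_hyperplane (y i).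

Definition weyl_tessellation (R : realType) (d n : nat)
    (y : 'I_n -> 'rV[R]_d) : set (set 'rV[R]_d) :=
  [set closure (connected_component (~` typeB_arrangement y) x)
     | x in ~` typeB_arrangement y].

(* {v : <v, y_1> <= ... <= <v, y_n> <= 0} *)
Definition weyl_chamber_cone (R : realType) (d n : nat)
    (y : 'I_n -> 'rV[R]_d) : set 'rV[R]_d :=
  [set v | (forall i j : 'I_n, j = i.+1 :> nat -> dot v (y i) <= dot v (y j))
        /\ (forall i : 'I_n, i.+1 = n -> dot v (y i) <= 0)].

(* The space of closed sets carries the Fell topology, generated by the sets
   {F : F meets G}, G open, and {F : F misses K}, K compact.  The same subbase
   is used here on all subsets of R^d; only its trace on the set of polyhedral
   cones matters. *)
Definition fell_subbase (R : realType) (d : nat) : set (set (set 'rV[R]_d)) :=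
  [set [set F | F `&` G !=set0] | G in @open 'rV[R]_d] `|`
  [set [set F | F `&` K = set0] | K in @compact 'rV[R]_d].

Definition fell_space (R : realType) (d : nat) : Type := set 'rV[R]_d.

HB.instance Definition _ (R : realType) (d : nat) :=
  Choice.on (fell_space R d).
HB.instance Definition _ (R : realType) (d : nat) :=
  isSubBaseTopological.Build (fell_space R d) (fell_subbase (R := R) (d := d))
    id.

(* Borel sets of the space of polyhedral cones, with the subspace topology. *)
Definition borel_cones (R : realType) (d : nat) : set (set (set 'rV[R]_d)) :=
  <<s @polyhedral_cone R d,
      [set U `&` @polyhedral_cone R d | U in @open (fell_space R d)] >>.

Definition euclidean_space (R : realType) (d : nat) :
    measurableType (@open 'rV[R]_d).-sigma :=
  g_sigma_algebraType (@open 'rV[R]_d).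

(* The joint distributions live on the product sigma-algebra of (R^d)^n. *)
Definition symmetrically_exchangeable (disp : measure_display)
    (T : measurableType disp) (R : realType) (P : probability T R) (d n : nat)
    (Y : 'I_n -> {RV P >-> euclidean_space R d}) : Prop :=
  forall (eps : 'I_n -> bool) (s : 'S_n)
    (A : set (n.-tuple (euclidean_space R d))), measurable A ->
    P [set w | A [tuple (Y i w : euclidean_space R d) | i < n]] =
    P [set w | A [tuple (signed_permutation eps s (fun j => Y j w) i
                          : euclidean_space R d) | i < n]].

(* Distributions of random cones are given by their values on [borel_cones]. *)
Definition same_distribution (R : realType) (d : nat)
    (mu nu : set (set 'rV[R]_d) -> \bar R) : Prop :=
  forall B, borel_cones B -> mu B = nu B.

Definition conditional_law (disp : measure_display) (T : measurableType disp)
    (R : realType) (P : probability T R) (d : nat) (X : T -> set 'rV[R]_d)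
    (E : set T) : set (set 'rV[R]_d) -> \bar R :=
  fun B => (fine (P ((X @^-1` B) `&` E)) / fine (P E))%:E.

Definition law_of_dual (R : realType) (d : nat)
    (mu : set (set 'rV[R]_d) -> \bar R) : set (set 'rV[R]_d) -> \bar R :=
  fun B => mu [set C | polyhedral_cone C /\ B (dual_cone C)].

Definition uniform_law (R : realType) (I : choiceType) (W B : set I) : R :=
  (#|` fset_set W|%fset%:R)^-1 * \sum_(C \in W) (\1_B C : R).

Definition weyl_cone_law (disp : measure_display) (T : measurableType disp)
    (R : realType) (P : probability T R) (d n : nat)
    (Y : 'I_n -> {RV P >-> euclidean_space R d}) :
    set (set 'rV[R]_d) -> \bar R :=
  fun B => (\int[P]_w
    (uniform_law R (weyl_tessellation (fun i => Y i w : 'rV[R]_d)) B)%:E)%E.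

Definition dual_weyl_cone_law (disp : measure_display)
    (T : measurableType disp) (R : realType) (P : probability T R) (d n : nat)
    (Y : 'I_n -> {RV P >-> euclidean_space R d}) :
    set (set 'rV[R]_d) -> \bar R :=
  let X w := pos_hull (successive_differences (fun i => Y i w : 'rV[R]_d)) in
  conditional_law P X [set w | X w <> setT].

Arguments symmetrically_exchangeable {disp T R} P {d n} Y.
Arguments weyl_cone_law {disp T R} P {d n} Y B.
Arguments dual_weyl_cone_law {disp T R} P {d n} Y B.

(* Main.v *)
Require Import Defs.
From mathcomp Require Import all_boot all_order all_algebra all_fingroup finmap.
From mathcomp Require Import ring lra zify.
From mathcomp Require Import all_classical all_reals all_analysis.
From mathcomp Require Import measurable_realfun.

(** The cones [weyl_chamber_cone (signed p y)], for [p] ranging over the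
2^n n! signed permutations, cover the space: every vector [v] has a signed
permutation that sorts the numbers <v, y_i> ([chambers_cover]). For [y] in
general position the ones different from {0} are the closures of pairwise
distinct components of the complement of the arrangement, that is, the elements
of the Weyl tessellation, each obtained from exactly one [p]
([weyl_tessellationE], [cone_inj], [open_chamber_neq0]). By symmetric
exchangeability the 2^n n! random cones [weyl_chamber_cone (signed p Y)] have
the law of the one without signs and permutation, so
  E (sum of 1_B over the tessellation) = 2^n n! P (G in B, G <> {0}),
and with all cones for B the expected number of cones is 2^n n! P (G <> {0}).
The quotient of the two is the conditional law of G. It is also the law of the
Weyl random cone as soon as the number of cones is almost surely constant, since
then the random normalisation leaves the expectation
([weyl_cone_law_conditional]).

The number of cones is constant because the number of regions of an arrangement
is determined by the linear dependences among the normal vectors: it satisfies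
the deletion--restriction recursion [regions_cons], in which only the question
whether a vector lies in the span of others is asked. For the images of the
roots under e_i |-> y_i the answer is the same for all [y] in general position
([rank_root_rows]): every set of roots spans the same subspace as a set of
simple roots of some chamber ([flat_simple_roots]), and general position says
that any [d] simple roots of a chamber have independent images.

The dual cones are treated by Farkas' lemma: the positive hull of the successive
differences is the dual of the chamber cone, and it is the whole space exactly
when the chamber cone is {0}. So the second assertion is the first one for the
set of cones whose dual lies in B.

Measurability needs the Fell topology to be second countable on closed sets
([fell_open_hit_miss]), and that hitting a compact box is a measurable event.
The latter is a projection along a compact set, which rational approximation
turns into countable operations ([measurable_exists_compact]). The number of
cones is only controlled on the event of general position, so that the
integrand of the law of the Weyl random cone is compared with a measurable
function outside a null set ([ge0_integral_eq_outside_null]). *)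

Set Implicit Arguments.
Unset Strict Implicit.
Unset Printing Implicit Defensive.

Import Order.TTheory GRing.Theory Num.Theory.
Import numFieldNormedType.Exports.

Local Open Scope classical_set_scope.
Local Open Scope ring_scope.

(** * Polyhedral cones and duality *)

Section dot_product.
Variables (R : realType) (d : nat).
Implicit Types (u v w : 'rV[R]_d) (C : set 'rV[R]_d).

Lemma dotC u v : dot u v = dot v u.
Proof. by apply: eq_bigr => k _; rewrite mulrC. Qed.

Lemma dotDr u v w : dot u (v + w) = dot u v + dot u w.
Proof. by rewrite -big_split; apply: eq_bigr => k _; rewrite !mxE mulrDr. Qed.

Lemma dotZr a u v : dot u (a *: v) = a * dot u v.
Proof. by rewrite mulr_sumr; apply: eq_bigr => k _; rewrite !mxE mulrCA. Qed.

Lemma dotNr u v : dot u (- v) = - dot u v.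
Proof. by rewrite -scaleN1r dotZr mulN1r. Qed.

Lemma dotBr u v w : dot u (v - w) = dot u v - dot u w.
Proof. by rewrite dotDr dotNr. Qed.

Lemma dot0r u : dot u 0 = 0.
Proof. by rewrite -(scale0r 0) dotZr mul0r. Qed.

Lemma dotDl u v w : dot (v + w) u = dot v u + dot w u.
Proof. by rewrite !(dotC _ u) dotDr. Qed.

Lemma dotZl a u v : dot (a *: v) u = a * dot v u.
Proof. by rewrite !(dotC _ u) dotZr. Qed.

Lemma dot0l u : dot 0 u = 0.
Proof. by rewrite dotC dot0r. Qed.

Lemma dot_suml (I : Type) (r : seq I) (P : pred I) (F : I -> 'rV[R]_d) u :
  dot (\sum_(i <- r | P i) F i) u = \sum_(i <- r | P i) dot (F i) u.
Proof. by apply: (big_morph (fun v => dot v u)) => [v w|]; rewrite ?dotDl ?dot0l. Qed.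

Lemma dot_delta u k : dot u (delta_mx 0 k) = u 0 k.
Proof.
rewrite /dot (bigD1 k) //= big1 => [|j jk]; rewrite mxE eqxx.
  by rewrite eqxx mulr1 addr0.
by rewrite (negPf jk) mulr0.
Qed.

Lemma dot_gt0 u : u != 0 -> 0 < dot u u.
Proof.
move=> u0; have sq_ge0 k : 0 <= u 0 k * u 0 k by exact: sqr_ge0.
rewrite lt_neqAle sumr_ge0 // andbT eq_sym psumr_neq0 //.
have /rV0Pn[k uk0] := u0; apply/hasP; exists k; rewrite ?mem_index_enum //=.
by rewrite lt_neqAle sq_ge0 eq_sym mulf_neq0.
Qed.

Lemma row_mul_colE (b : 'rV[R]_d) (x : 'cV[R]_d) :
  b *m x = (dot x^T b)%:M.
Proof.
rewrite [LHS]mx11_scalar mxE; congr (_%:M).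
by apply: eq_bigr => k _; rewrite mxE mulrC.
Qed.

End dot_product.

Section polyhedral_cones.
Variables (R : realType) (d : nat).
Implicit Types (u v w : 'rV[R]_d) (C : set 'rV[R]_d) (s : seq 'rV[R]_d).

Definition halfspaces s : set 'rV[R]_d := [set v | {in s, forall b, dot v b <= 0}].

Lemma polyhedral_halfspaces s : polyhedral_cone (halfspaces s).
Proof.
exists (size s), (tnth (in_tuple s)); apply/seteqP; split=> v /= Hv.
  by move=> i; apply: Hv; rewrite mem_tnth.
by move=> b bs; have /tnthP[i ->] : b \in in_tuple s.
Qed.

(** Fourier--Motzkin elimination of the coefficient [t] of [a]. A constraint
[b] with [dot a b > 0] bounds [t] from below and one with [dot a b < 0] bounds
it from above; the bounds are compatible when each lower one is at most each
upper one, which is the constraint obtained by eliminating [t] from the pair. *)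
Lemma fourier_motzkin a s : exists s',
  halfspaces s' = [set v + t *: a | v in halfspaces s & t in [set t | 0 <= t]].
Proof.
pose s' := [seq b <- s | dot a b <= 0] ++
  [seq dot a b.1 *: b.2 - dot a b.2 *: b.1 | b <-
    [seq b <- [seq (b, c) | b <- s, c <- s] |
       (0 < dot a b.1) && (dot a b.2 < 0)]].
exists s'; apply/seteqP; split=> [v Hv|_ [v Hv [t /= t0 <-]]].
(* the largest lower bound on [t] *)
- pose t := \big[Num.max/0]_(b <- s | 0 < dot a b) (dot v b / dot a b).
  have t0 : 0 <= t by rewrite /t bigmax_ge_id.
  exists (v - t *: a); last by exists t => //; rewrite subrK.
  move=> c cs; rewrite dotDl -scaleNr dotZl mulNr subr_le0.
  have [ac|ac] := ltP 0 (dot a c).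
    by rewrite -ler_pdivrMr// /t (le_trans _ (le_bigmax_seq _ c _ _ cs ac)).
  have c_s' : c \in s' by rewrite mem_cat mem_filter ac cs.
  rewrite /t big_seq_cond; elim/big_ind: _ => [|x y Hx Hy|b /andP[bs ab]].
  - by rewrite mul0r; apply: Hv.
  - by rewrite maxEle; case: ifP.
  have [ac0|ac0] := eqVneq (dot a c) 0; first by rewrite ac0 mulr0; exact: Hv.
  have /Hv : dot a b *: c - dot a c *: b \in s'.
    rewrite mem_cat orbC; apply/orP; left; apply/mapP; exists (b, c) => //=.
    by rewrite mem_filter /= ab lt_neqAle ac0 ac; apply/allpairsP; exists (b, c).
  rewrite dotBr !dotZr subr_le0 => le_bc.
  by rewrite mulrAC ler_pdivlMr // mulrC [leRHS]mulrC.
- move=> b; rewrite mem_cat => /orP[|/mapP[[b1 b2]]].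
    rewrite mem_filter => /andP[ab /Hv vb]; rewrite dotDl dotZl.
    by rewrite -[leRHS]addr0 lerD // mulr_ge0_le0.
  rewrite mem_filter /= => /andP[/andP[a1 a2] /allpairsP[[c1 c2] /= [+ + [e1 e2]]]].
  rewrite -e1 -e2 => /Hv H1 /Hv H2 ->.
  rewrite dotBr !dotZr !dotDl !dotZl.
  have := mulr_ge0_le0 (ltW a1) H2; have := mulr_le0 (ltW a2) H1; lra.
Qed.

Lemma halfspaces_zero : exists s, halfspaces s = [set 0].
Proof.
pose e k : 'rV[R]_d := delta_mx 0 k.
exists ([seq e k | k <- enum 'I_d] ++ [seq - e k | k <- enum 'I_d]).
apply/seteqP; split=> [v Hv|_ -> b _] /=; last by rewrite dot0l.
apply/rowP => k; rewrite mxE; apply/eqP; rewrite eq_le -dot_delta.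
apply/andP; split; first by apply: Hv; rewrite mem_cat map_f ?mem_enum.
rewrite -oppr_le0 -dotNr; apply: Hv.
by rewrite mem_cat orbC (map_f (fun k => - e k)) ?mem_enum.
Qed.

(** Weyl's half of the Minkowski--Weyl theorem: the generators are added one at
a time. *)
Lemma pos_hull_halfspaces m (x : 'I_m -> 'rV[R]_d) :
  exists s, pos_hull x = halfspaces s.
Proof.
elim: m x => [|m IH] x.
  have [s sE] := halfspaces_zero; exists s; rewrite sE.
  apply/seteqP; split=> [_ [l _ ->]|_ ->] /=; first by rewrite big_ord0.
  by exists (fun=> 0) => //; rewrite big_ord0.
have [s sE] := IH (fun i => x (lift ord0 i)).
have [s' s'E] := fourier_motzkin (x ord0) s; exists s'; rewrite s'E -sE.
apply/seteqP; split=> [_ [l l0 ->]|_ [_ [l l0 ->] [t /= t0 <-]]].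
  rewrite big_ord_recl addrC.
  exists (\sum_(i < m) l (lift ord0 i) *: x (lift ord0 i)).
    by exists (fun i => l (lift ord0 i)).
  by exists (l ord0); first exact: l0.
exists (fun i => if unlift ord0 i is Some j then l j else t).
  by move=> i; case: unliftP => [j _|_].
rewrite big_ord_recl unlift_none addrC; congr (_ + _).
by apply: eq_bigr => i _; rewrite liftK.
Qed.

Lemma pos_hull_polyhedral m (x : 'I_m -> 'rV[R]_d) : polyhedral_cone (pos_hull x).
Proof. by have [s ->] := pos_hull_halfspaces x; exact: polyhedral_halfspaces. Qed.

Lemma pos_hull_gen m (x : 'I_m -> 'rV[R]_d) i : pos_hull x (x i).
Proof.
exists (fun j => (j == i)%:R) => [j|]; first exact: ler0n.
rewrite (bigD1 i) //= eqxx scale1r big1 ?addr0 // => j /negPf->.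
by rewrite scale0r.
Qed.

Lemma dual_pos_hull m (x : 'I_m -> 'rV[R]_d) :
  dual_cone (pos_hull x) = [set v | forall i, dot v (x i) <= 0].
Proof.
apply/seteqP; split=> [v Hv i|v Hv _ [l l0 ->]] /=.
  by rewrite dotC; apply: Hv; exact: pos_hull_gen.
rewrite dot_suml sumr_le0 // => i _.
by rewrite dotZl mulr_ge0_le0 // dotC.
Qed.

(** Farkas' lemma: the vectors of the inequalities that cut out a finitely
generated cone belong to its dual, so membership in the bidual gives back the
inequalities. *)
Lemma dual_dual_pos_hull m (x : 'I_m -> 'rV[R]_d) :
  dual_cone (dual_cone (pos_hull x)) = pos_hull x.
Proof.
apply/seteqP; split=> [v|v Hv u]; last by move=> /(_ _ Hv); rewrite dotC.
have [s ->] := pos_hull_halfspaces x => Hv b bs; rewrite dotC; apply: Hv.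
by move=> u; apply.
Qed.

End polyhedral_cones.

Section chamber_cone.
Variables (R : realType) (d n : nat).
Implicit Types (v : 'rV[R]_d) (y : 'I_n -> 'rV[R]_d).

(** The coordinates <v, y_1>, ..., <v, y_n> followed by a terminal 0, so that
the condition on the last coordinate has the same form as the others. *)
Definition coords y v (k : nat) : R := if insub k is Some j then dot v (y j) else 0.

Lemma coords_ord y v (i : 'I_n) : coords y v i = dot v (y i).
Proof. by rewrite /coords valK. Qed.

Lemma coords_last y v : coords y v n = 0.
Proof. by rewrite /coords insubF ?ltnn. Qed.

Lemma dot_successive_differences y v (i : 'I_n) :
  dot v (successive_differences y i) = coords y v i - coords y v i.+1.
Proof.
rewrite coords_ord /successive_differences /coords.
by case: insubP => [j _ _|_]; rewrite ?dotBr ?subr0.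
Qed.

Lemma weyl_chamber_coneE y : weyl_chamber_cone y =
  [set v | forall i, dot v (successive_differences y i) <= 0].
Proof.
apply/seteqP; split=> [v [Hs Hl] i|v Hv] /=.
  rewrite dot_successive_differences subr_le0 coords_ord /coords.
  case: insubP => [j _ ji|]; first exact: Hs.
  by rewrite -leqNgt => ni; apply: Hl; apply/eqP; rewrite eqn_leq ni ltn_ord.
split=> [i j ji|i iE]; have := Hv i; rewrite dot_successive_differences subr_le0.
  by rewrite -ji !coords_ord.
by rewrite iE coords_last coords_ord.
Qed.

Lemma weyl_chamber_cone_polyhedral y : polyhedral_cone (weyl_chamber_cone y).
Proof. by exists n, (successive_differences y); rewrite weyl_chamber_coneE. Qed.

Lemma weyl_chamber_cone_dual y :
  weyl_chamber_cone y = dual_cone (pos_hull (successive_differences y)).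
Proof. by rewrite dual_pos_hull weyl_chamber_coneE. Qed.

Lemma dual_weyl_chamber_cone y :
  dual_cone (weyl_chamber_cone y) = pos_hull (successive_differences y).
Proof. by rewrite weyl_chamber_cone_dual dual_dual_pos_hull. Qed.

Lemma dual_cone_zero : dual_cone [set 0 : 'rV[R]_d] = setT.
Proof. by apply/seteqP; split=> // v _ _ ->; rewrite dot0l. Qed.

Lemma dual_cone_setT : dual_cone [set: 'rV[R]_d] = [set 0].
Proof.
apply/seteqP; split=> [v Hv|_ -> u _] /=; last by rewrite dot0r.
apply/eqP/negP => /negP /dot_gt0; rewrite ltNge => /negP; apply.
exact: Hv.
Qed.

Lemma pos_hull_eqT y : (pos_hull (successive_differences y) = setT) <->
  (weyl_chamber_cone y = [set 0]).
Proof.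
split=> [e|]; first by rewrite weyl_chamber_cone_dual e dual_cone_setT.
by rewrite -dual_weyl_chamber_cone => ->; exact: dual_cone_zero.
Qed.

End chamber_cone.

(** * Counting the regions of an arrangement *)

Section counting_regions.
Variables (R : realType) (d : nat).
Implicit Types (x u : 'cV[R]_d) (k : 'rV[R]_d) (K : seq 'rV[R]_d) (s : seq bool).

(** The bit [true] stands for a negative value. *)
Definition has_signs K s x :=
  all2 (fun k b => 0 < (-1) ^+ (b : bool) * (k *m x) 0 0) K s.

Definition realizable m (A : 'M[R]_(m, d)) K s :=
  exists2 x, A *m x = 0 & has_signs K s x.

Fixpoint bitseqs (m : nat) : seq (seq bool) :=
  if m is m'.+1 then map (cons false) (bitseqs m') ++ map (cons true) (bitseqs m')
  else [:: [::]].

(** The regions into which the hyperplanes orthogonal to [K] cut the subspace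
of the solutions of [A *m x = 0]. *)
Definition regions m (A : 'M[R]_(m, d)) K :=
  count (fun s => `[< realizable A K s >]) (bitseqs (size K)).

Lemma row_mulD k x u : (k *m (x + u)) 0 0 = (k *m x) 0 0 + (k *m u) 0 0.
Proof. by rewrite mulmxDr mxE. Qed.

Lemma row_mulZ k (a : R) x : (k *m (a *: x)) 0 0 = a * (k *m x) 0 0.
Proof. by rewrite -scalemxAr mxE. Qed.

Lemma bitseqs_uniq m : uniq (bitseqs m).
Proof.
elim: m => //= m IH; rewrite cat_uniq !map_inj_uniq ?IH; try by move=> ? ? [].
by rewrite andbT; apply/hasPn => _ /mapP[s _ ->]; apply/mapP => -[].
Qed.

Lemma mem_bitseqs s : s \in bitseqs (size s).
Proof.
elim: s => //= b s IH; rewrite mem_cat.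
by case: b; rewrite ?(map_f (cons true)) ?orbT ?(map_f (cons false)).
Qed.

Lemma has_signs_perturb K s x u : has_signs K s x ->
  exists2 e, 0 < e & forall t, `|t| <= e -> has_signs K s (x + t *: u).
Proof.
rewrite /has_signs; elim: K s => [|k K IH] [|b s] //=; first by exists 1.
move=> /andP[kx /IH[e e0 He]].
set a := (-1) ^+ b * _ in kx; pose c := (k *m u) 0 0.
exists (Num.min e (a / (2 * (`|c| + 1)))).
  by rewrite lt_min e0 /= divr_gt0 // mulr_gt0 // ltr_wpDl.
move=> t; rewrite le_min => /andP[te ta]; rewrite He // andbT.
rewrite row_mulD row_mulZ mulrDr -/a -/c.
have : `|(-1) ^+ b * (t * c)| < a.
  rewrite normrM normr_sign mul1r normrM.
  move: ta; rewrite ler_pdivlMr ?mulr_gt0 ?ltr_wpDl //.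
  have := normr_ge0 c; have := normr_ge0 t; nra.
by rewrite ltr_norml => /andP[]; lra.
Qed.

Lemma not_submx_witness m (A : 'M[R]_(m, d)) k : ~~ (k <= A)%MS ->
  exists2 u : 'cV_d, A *m u = 0 & (k *m u) 0 0 != 0.
Proof.
rewrite submxE => /rV0Pn[j kj]; exists (col j (cokermx A)).
  by rewrite colE mulmxA mulmx_coker mul0mx.
by rewrite colE mulmxA -colE mxE.
Qed.

Lemma submx_annihilator m (A : 'M[R]_(m, d)) k :
  (forall u : 'cV_d, A *m u = 0 -> (k *m u) 0 0 = 0) -> (k <= A)%MS.
Proof.
move=> H; apply/negP => /negP /not_submx_witness[u Au /eqP]; apply; exact: H.
Qed.

(** A point on the hyperplane of [k] is moved off it along a direction in the
subspace of [A]. *)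
Lemma realizable_extend m (A : 'M[R]_(m, d)) k K s : ~~ (k <= A)%MS ->
  realizable A K s -> exists b, realizable A (k :: K) (b :: s).
Proof.
move=> /not_submx_witness[u Au ku] [x Ax Kx].
have sg (y : 'cV[R]_d) : A *m y = 0 -> has_signs K s y -> (k *m y) 0 0 != 0 ->
    exists b, realizable A (k :: K) (b :: s).
  move=> Ay Ky; rewrite neq_lt => /orP[ky|ky].
    by exists true, y => //; rewrite /has_signs /= expr1 mulN1r oppr_gt0 ky.
  by exists false, y => //; rewrite /has_signs /= expr0 mul1r ky.
have [kx|kx] := eqVneq ((k *m x) 0 0) 0; last exact: (sg x).
have [e e0 He] := has_signs_perturb u Kx; apply: (sg (x + e *: u)).
- by rewrite mulmxDr -scalemxAr Ax Au scaler0 addr0.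
- by apply: He; rewrite gtr0_norm.
- by rewrite row_mulD row_mulZ kx add0r mulf_neq0 // gt_eqF.
Qed.

Lemma realizable_all m (A : 'M[R]_(m, d)) K :
  all (fun k => ~~ (k <= A)%MS) K -> exists s, realizable A K s.
Proof.
elim: K => [_|k K IH /= /andP[kA /IH[s /(realizable_extend kA)[b]]]].
  by exists [::], 0; rewrite ?mulmx0.
by exists (b :: s).
Qed.

(** Both signs of [k] extend [s] exactly when the region of [s] is cut by the
hyperplane of [k]: two points on either side have a convex combination on it,
and a point on it can be moved to either side. *)
Lemma realizable_both m (A : 'M[R]_(m, d)) k K s : ~~ (k <= A)%MS ->
  (realizable A (k :: K) (false :: s) /\ realizable A (k :: K) (true :: s)) <->
  realizable (col_mx k A) K s.
Proof.
move=> kA; split=> [[[x Ax /andP[kx Kx]] [y Ay /andP[ky Ky]]]|].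
  move: kx ky; rewrite expr0 mul1r expr1 mulN1r oppr_gt0 => kx ky.
  set a := (k *m x) 0 0 in kx; set b := (k *m y) 0 0 in ky.
  exists (- b *: x + a *: y).
    rewrite mul_col_mx !mulmxDr -!scalemxAr Ax Ay !scaler0 addr0.
    rewrite (_ : _ + _ = 0) ?col_mx0 //.
    apply/rowP => i; rewrite !ord1 [RHS]mxE scalemxAr scalemxAr -mulmxDr.
    by rewrite row_mulD !row_mulZ -/a -/b; ring.
  clearbody a b; move: Kx Ky; rewrite /has_signs.
  elim: K s => [|h K IH] [|c s] //= /andP[hx Kx] /andP[hy Ky].
  rewrite IH // andbT row_mulD !row_mulZ.
  rewrite mulrDr !(mulrCA (_ ^+ _)) addr_gt0 //; apply: mulr_gt0 => //.
  by rewrite oppr_gt0.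
move=> [x]; rewrite mul_col_mx -col_mx0 => /eq_col_mx[kx Ax] Kx.
have [u Au ku] := not_submx_witness kA.
have [e e0 He] := has_signs_perturb ((k *m u) 0 0 *: u) Kx.
have k2 : 0 < e * ((k *m u) 0 0 * (k *m u) 0 0).
  by rewrite mulr_gt0 // -expr2 exprn_even_gt0.
split.
  exists (x + e *: ((k *m u) 0 0 *: u)).
    by rewrite mulmxDr -!scalemxAr Ax Au !scaler0 addr0.
  rewrite /has_signs /= -/(has_signs _ _ _) He ?gtr0_norm //.
  by rewrite expr0 mul1r row_mulD !row_mulZ kx mxE add0r k2.
exists (x + (- e) *: ((k *m u) 0 0 *: u)).
  by rewrite mulmxDr -!scalemxAr Ax Au !scaler0 addr0.
rewrite /has_signs /= -/(has_signs _ _ _) He ?normrN ?gtr0_norm //.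
by rewrite expr1 row_mulD !row_mulZ kx mxE add0r mulN1r mulNr opprK k2.
Qed.

Lemma regions_nil m (A : 'M[R]_(m, d)) : regions A [::] = 1%N.
Proof.
by rewrite /regions /= asboolT //; exists 0; rewrite ?mulmx0.
Qed.

Lemma regions_cons_dep m (A : 'M[R]_(m, d)) k K : (k <= A)%MS ->
  regions A (k :: K) = 0%N.
Proof.
move=> /submxP[D ->]; apply/eqP; rewrite -leqn0 leqNgt -has_count.
apply/hasPn => s _; apply/negP => /asboolP[x Ax].
case: s => //= b s /andP[]; rewrite -mulmxA Ax mulmx0 mxE mulr0.
by rewrite ltxx.
Qed.

(** Deletion--restriction: a region of [K] is split in two by the hyperplane of
[k] when it meets it, and is left whole otherwise. *)
Lemma regions_cons m (A : 'M[R]_(m, d)) k K : ~~ (k <= A)%MS ->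
  regions A (k :: K) = (regions A K + regions (col_mx k A) K)%N.
Proof.
move=> kA; rewrite /regions /= count_cat !count_map.
set p0 := preim _ _; set p1 := preim _ _.
rewrite -count_predUI; congr (_ + _)%N; apply: eq_count => s /=.
  rewrite /p0 /p1 /= -asbool_or; apply: asbool_equiv_eq; split.
    by case=> -[x Ax /andP[_ Kx]]; exists x.
  by move=> /(realizable_extend kA)[[]]; [right|left].
rewrite /p0 /p1 /= -asbool_and; apply: asbool_equiv_eq.
exact: realizable_both.
Qed.

End counting_regions.

Section row_selection.
Variables (F : fieldType) (n d : nat).

Lemma row_free_rowsub k m (N : 'M[F]_(m, d)) (h : 'I_k -> 'I_m) :
  injective h -> row_free N -> row_free (rowsub h N).
Proof.
move=> hI Nf; rewrite -row_leq_rank rowsubE mxrankMfree // row_leq_rank.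
apply/row_freeP; exists (rowsub h 1%:M)^T; apply/matrixP => i j.
rewrite !mxE (bigD1 (h i)) //= !mxE eqxx mul1r big1 ?addr0.
  by rewrite (inj_eq hI) eq_sym.
by move=> l lh; rewrite !mxE eq_sym (negPf lh) mul0r.
Qed.

Lemma extend_injection k (h : 'I_k -> 'I_n) (kd : (k <= d)%N) : injective h ->
  (d <= n)%N ->
  exists2 f : 'I_d -> 'I_n, injective f & forall i, f (widen_ord kd i) = h i.
Proof.
case: n h => [|n'] h hI dn.
  have d0 : d = 0%N by move: dn; rewrite leqn0 => /eqP.
  by exists (cast_ord d0) => i; [case: (cast_ord d0 i) | case: (h i)].
pose l := codom h ++ [seq x <- enum 'I_n'.+1 | x \notin codom h].
have lu : uniq l.
  rewrite cat_uniq filter_uniq ?enum_uniq // andbT.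
  rewrite (map_inj_uniq hI) enum_uniq /=.
  by apply/hasPn => x; rewrite mem_filter => /andP[].
have ls : size l = n'.+1.
  have /perm_size-> : perm_eq l (enum 'I_n'.+1); last by rewrite size_enum_ord.
  apply: uniq_perm; rewrite ?enum_uniq // => x.
  by rewrite mem_cat mem_filter mem_enum andbT orbN.
exists (fun i => nth ord0 l i) => [i j /eqP|i].
  rewrite nth_uniq ?ls ?(leq_trans (ltn_ord _)) // => /eqP; exact: val_inj.
rewrite /l nth_cat size_codom card_ord /= ltn_ord.
by rewrite (nth_map i) ?size_enum_ord //= nth_ord_enum.
Qed.

(** Fewer than [d] rows are part of an independent family of [d] rows, because
[d <= n] leaves enough rows to complete them. *)
Lemma rank_rowsub_general k (N : 'M[F]_(n, d)) (h : 'I_k -> 'I_n) :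
  (d <= n)%N ->
  (forall f : 'I_d -> 'I_n, injective f -> row_free (rowsub f N)) ->
  injective h -> \rank (rowsub h N) = minn k d.
Proof.
move=> dn Nf hI; have [kd|dk] := leqP k d.
  have [f fI fh] := extend_injection kd hI dn.
  apply/eqP; suff : row_free (rowsub h N) by [].
  rewrite (_ : rowsub h N = rowsub (widen_ord kd) (rowsub f N)).
    apply: row_free_rowsub; last exact: Nf.
    by move=> i j /(congr1 val) /= /val_inj.
  by apply/matrixP => i j; rewrite !mxE fh.
apply/eqP; rewrite eqn_leq rank_leq_col /=.
pose g := widen_ord (ltnW dk); have gI : injective g.
  by move=> i j /(congr1 val) /= /val_inj.
have /eqP := Nf (h \o g) (inj_comp hI gI) => {1}<-; apply: mxrankS.
by apply/row_subP => i; rewrite row_rowsub /= -row_rowsub row_sub.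
Qed.

End row_selection.

(** * Chambers of type B *)

Section sequences_of_coordinates.
Variable (R : realType).

Lemma nondecreasing_upto (z : nat -> R) n :
  (forall i : 'I_n, z i <= z i.+1) ->
  forall a b, (a <= b <= n)%N -> z a <= z b.
Proof.
move=> zS a; elim=> [|b IH]; first by rewrite leqn0 => /andP[/eqP->].
rewrite leq_eqVlt ltnS => /andP[/orP[/eqP->//|ab] bn].
by rewrite (le_trans (IH _)) ?ab ?(ltnW bn) //; exact: (zS (Ordinal bn)).
Qed.

(** A nondecreasing sequence with equal values at the ends of a stretch makes no
step inside it, so a sequence whose steps vanish with those of the first one
also has equal values at the ends. *)
Lemma constant_stretch (z z' : nat -> R) n :
  (forall i : 'I_n, z i <= z i.+1) ->
  (forall i : 'I_n, z i = z i.+1 -> z' i = z' i.+1) ->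
  forall a b, (a <= b <= n)%N -> z a = z b -> z' a = z' b.
Proof.
move=> zS zz' a; elim=> [|b IH]; first by rewrite leqn0 => /andP[/eqP->].
rewrite leq_eqVlt ltnS => /andP[/orP[/eqP->//|ab] bn] zab.
have zb : z b = z b.+1.
  apply/eqP; rewrite eq_le (zS (Ordinal bn)) -zab /=.
  by apply: (nondecreasing_upto zS); rewrite ab ltnW.
rewrite -(zz' (Ordinal bn) zb); apply: IH; first by rewrite ab ltnW.
by rewrite zab zb.
Qed.

End sequences_of_coordinates.

(** A Weyl chamber is indexed by the signed permutation that sorts it. *)
Notation chamber n := ({ffun 'I_n -> bool} * 'S_n)%type.

Section typeB_chambers.
Variables (R : realType) (n : nat).



Section in_dimension_d.
Variable d : nat.
Implicit Types (v : 'rV[R]_d) (y : 'I_n -> 'rV[R]_d) (p : chamber n).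

Definition signed p y : 'I_n -> 'rV[R]_d := signed_permutation p.1 p.2 y.

Definition simple_root p y (i : 'I_n) : 'rV[R]_d :=
  successive_differences (signed p y) i.

Definition open_chamber p y : set 'rV[R]_d :=
  [set v | forall i, dot v (simple_root p y i) < 0].

(** One of each pair of opposite roots. *)
Definition positive_roots y : seq 'rV[R]_d :=
  [seq y i | i <- enum 'I_n] ++
  [seq y q.1.1 + (-1) ^+ (q.2 : bool) *: y q.1.2 |
     q : 'I_n * 'I_n * bool <- enum {: 'I_n * 'I_n * bool} & (q.1.1 < q.1.2)%N].

Lemma mem_positive_rootsP y (k : 'rV[R]_d) : reflect
  ((exists i, k = y i) \/
   (exists (i j : 'I_n) (b : bool), (i < j)%N /\ k = y i + (-1) ^+ b *: y j))
  (k \in positive_roots y).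
Proof.
rewrite mem_cat; apply: (iffP orP) => -[].
- by move=> /mapP[i _ ->]; left; exists i.
- move=> /mapP[[[i j] b]]; rewrite mem_filter /= => /andP[ij _] ->.
  by right; exists i, j, b.
- by move=> [i ->]; left; rewrite map_f ?mem_enum.
- move=> [i [j [b [ij ->]]]]; right; apply/mapP; exists (i, j, b) => //.
  by rewrite mem_filter mem_enum andbT.
Qed.

Lemma typeB_arrangementE y :
  typeB_arrangement y = [set v | exists2 k, k \in positive_roots y & dot v k = 0].
Proof.
apply/seteqP; split=> [v [[[i j] /= ij vH]|[i _ vi]]|v [k]].
- case: vH => vH; rewrite /orthogonal_hyperplane /= in vH.
    exists (y i + y j) => //; apply/mem_positive_rootsP; right.
    by exists i, j, false; rewrite expr0 scale1r.
  exists (y i - y j) => //; apply/mem_positive_rootsP; right.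
  by exists i, j, true; rewrite expr1 scaleN1r.
- by exists (y i) => //; apply/mem_positive_rootsP; left; exists i.
- move=> /mem_positive_rootsP[[i ->]|[i [j [b [ij ->]]]]] vk.
    by right; exists i.
  left; exists (i, j) => //; case: b vk => vk; [right|left].
    by rewrite expr1 scaleN1r in vk.
  by rewrite expr0 scale1r in vk.
Qed.

Lemma coords_signed p y v (i : 'I_n) :
  coords (signed p y) v i = (-1) ^+ p.1 i * dot v (y (p.2 i)).
Proof. by rewrite coords_ord dotZr. Qed.

Lemma dot_simple_root p y v i :
  dot v (simple_root p y i) = coords (signed p y) v i - coords (signed p y) v i.+1.
Proof. exact: dot_successive_differences. Qed.

Lemma weyl_chamber_coneP p y v : weyl_chamber_cone (signed p y) v <->
  forall i : 'I_n, coords (signed p y) v i <= coords (signed p y) v i.+1.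
Proof.
rewrite weyl_chamber_coneE; split=> H i; have := H i;
by rewrite dot_successive_differences subr_le0.
Qed.

Lemma simple_root_positive p y i : exists k (b : bool),
  k \in positive_roots y /\ simple_root p y i = (-1) ^+ b *: k.
Proof.
rewrite /simple_root /successive_differences.
case: insubP => [j _ jE|_]; last first.
  exists (y (p.2 i)), (p.1 i); split=> //.
  by apply/mem_positive_rootsP; left; exists (p.2 i).
have ij : p.2 i != p.2 j.
  by rewrite (inj_eq perm_inj) -val_eqE /= jE neq_ltn ltnSn.
rewrite /signed /signed_permutation.
set a := p.1 i; set b := p.1 j; set u := y _; set w := y _.
move: ij; rewrite -val_eqE neq_ltn => /orP[ij|ij].
  exists (u + (-1) ^+ (~~ (a (+) b)) *: w), a; split.
    by apply/mem_positive_rootsP; right; do 3 eexists; split; last by [].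
  rewrite scalerDr scalerA.
  by case: a b => [] []; rewrite /= ?(expr0, expr1, mulN1r, mul1r, opprK, scale1r, scaleN1r).
exists (w + (-1) ^+ (~~ (a (+) b)) *: u), (~~ b); split.
  by apply/mem_positive_rootsP; right; do 3 eexists; split; last by [].
rewrite scalerDr scalerA addrC.
by case: a b => [] []; rewrite /= ?(expr0, expr1, mulN1r, mul1r, opprK, scale1r, scaleN1r).
Qed.

(** In the signed coordinates of a chamber, ordered and of one sign there, the
values of a root on the chamber and on its faces can be read off. *)
Lemma positive_root_coords p y k : k \in positive_roots y ->
  (exists2 a, (a < n)%N & exists e : bool, forall v,
     dot v k = (-1) ^+ e * coords (signed p y) v a) \/
  (exists a b, (a < b < n)%N /\ exists e f : bool, forall v,
     dot v k = (-1) ^+ e * (coords (signed p y) v a +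
                            (-1) ^+ f * coords (signed p y) v b)).
Proof.
have yE j v : dot v (y j) =
    (-1) ^+ p.1 ((p.2^-1)%g j) * coords (signed p y) v ((p.2^-1)%g j).
  by rewrite coords_signed permKV signrMK.
move=> /mem_positive_rootsP[[i ->]|[i [j [b [ij ->]]]]].
  left; exists ((p.2^-1)%g i) => //; exists (p.1 ((p.2^-1)%g i)) => v.
  exact: yE.
right; set i' := (p.2^-1)%g i; set j' := (p.2^-1)%g j.
have : i' != j' by rewrite (inj_eq perm_inj) -val_eqE neq_ltn ij.
rewrite -val_eqE neq_ltn => /orP[ij'|ij'].
  exists i', j'; rewrite ij' ltn_ord; split=> //.
  exists (p.1 i'), (p.1 i' (+) b (+) p.1 j') => v.
  rewrite dotDr dotZr !yE -/i' -/j'; move: (coords _ _ _) (coords _ _ _) => z1 z2.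
  by case: (p.1 i') b (p.1 j') => [] [] []; rewrite /= ?expr0 ?expr1; ring.
exists j', i'; rewrite ij' ltn_ord; split=> //.
exists (b (+) p.1 j'), (p.1 i' (+) b (+) p.1 j') => v.
rewrite dotDr dotZr !yE -/i' -/j'; move: (coords _ _ _) (coords _ _ _) => z1 z2.
by case: (p.1 i') b (p.1 j') => [] [] []; rewrite /= ?expr0 ?expr1; ring.
Qed.

Lemma weyl_chamber_mono p y v : weyl_chamber_cone (signed p y) v ->
  forall a b, (a <= b <= n)%N -> coords (signed p y) v a <= coords (signed p y) v b.
Proof. by move=> /weyl_chamber_coneP; exact: nondecreasing_upto. Qed.

Lemma weyl_chamber_le0 p y v a : weyl_chamber_cone (signed p y) v -> (a <= n)%N ->
  coords (signed p y) v a <= 0.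
Proof.
move=> vp an; rewrite -(coords_last (signed p y) v).
by apply: weyl_chamber_mono; rewrite ?an /=.
Qed.

Let sign_mul_eq0 (e : bool) (t : R) : (-1) ^+ e * t = 0 -> t = 0.
Proof. by move=> /eqP; rewrite mulf_eq0 signr_eq0 => /eqP. Qed.

(** On a closed chamber a root is a combination of simple roots with
coefficients of one sign, so it vanishes at a point of the chamber only if all
the simple roots in it do. *)
Lemma positive_root_vanish p y v v' k : weyl_chamber_cone (signed p y) v ->
  (forall i, dot v (simple_root p y i) = 0 -> dot v' (simple_root p y i) = 0) ->
  k \in positive_roots y -> dot v k = 0 -> dot v' k = 0.
Proof.
move=> vp vv' kroot.
have /(constant_stretch (proj1 (weyl_chamber_coneP _ _ _) vp)) zz' (i : 'I_n) :
    coords (signed p y) v i = coords (signed p y) v i.+1 ->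
    coords (signed p y) v' i = coords (signed p y) v' i.+1.
  move=> e; apply/eqP; rewrite -subr_eq0 -dot_simple_root; apply/eqP/vv'.
  by rewrite dot_simple_root e subrr.
have z0 a : (a < n)%N -> coords (signed p y) v a = 0 -> coords (signed p y) v' a = 0.
  move=> an za; rewrite -(coords_last (signed p y) v'); apply: zz'.
    by rewrite leqnn ltnW.
  by rewrite za coords_last.
have [[a an [e kE]]|[a [b [/andP[ab bn] [e [f kE]]]]]] :=
  positive_root_coords p kroot.
  by rewrite !kE => /sign_mul_eq0 /(z0 _ an) ->; rewrite mulr0.
rewrite !kE => /sign_mul_eq0.
case: f {kE} => /=; rewrite ?expr1 ?expr0 ?mul1r ?mulN1r => zab.
  rewrite (zz' a b) ?subrr ?mulr0 // ?(ltnW ab) ?(ltnW bn) //.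
  by apply/eqP; rewrite -subr_eq0 zab.
have za := weyl_chamber_le0 vp (ltnW (ltn_trans ab bn)).
have zb := weyl_chamber_le0 vp (ltnW bn).
by rewrite (z0 a) ?(z0 b) ?addr0 ?mulr0 ?(ltn_trans ab bn) //; lra.
Qed.

Lemma open_chamber_sub p y : open_chamber p y `<=` weyl_chamber_cone (signed p y).
Proof. by move=> v Hv; rewrite weyl_chamber_coneE => i; exact: ltW (Hv i). Qed.

Lemma open_chamber_mono p y v : open_chamber p y v ->
  forall a b, (a < b <= n)%N -> coords (signed p y) v a < coords (signed p y) v b.
Proof.
move=> vp a b /andP[ab bn]; have an := leq_trans ab bn.
apply: lt_le_trans (_ : coords (signed p y) v a.+1 <= _); last first.
  by apply: weyl_chamber_mono; [exact: open_chamber_sub|rewrite ab].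
by have := vp (Ordinal an); rewrite dot_simple_root subr_lt0.
Qed.

Lemma open_chamber_lt0 p y v a : open_chamber p y v -> (a < n)%N ->
  coords (signed p y) v a < 0.
Proof.
move=> vp an; rewrite -(coords_last (signed p y) v).
by apply: open_chamber_mono; rewrite ?an /=.
Qed.

(** The coordinates are negative and increasing on the open chamber; so their
sums and their differences, earlier minus later, are negative there. *)
Lemma open_chamber_sign p y k : k \in positive_roots y ->
  exists e : bool, forall v, open_chamber p y v -> 0 < (-1) ^+ e * dot v k.
Proof.
move=> kroot; have [[a an [e kE]]|[a [b [/andP[ab bn] [e [f kE]]]]]] :=
  positive_root_coords p kroot; exists (~~ e) => v vp; rewrite kE.
  have := open_chamber_lt0 vp an.
  by case: e {kE} => /=; rewrite ?expr1 ?expr0; lra.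
have := open_chamber_mono vp (_ : (a < b <= n)%N); rewrite ab (ltnW bn) => /(_ isT).
have := open_chamber_lt0 vp bn.
by case: e f {kE} => -[] /=; rewrite ?expr1 ?expr0; lra.
Qed.

Lemma open_chamber_generic p y : open_chamber p y `<=` ~` typeB_arrangement y.
Proof.
move=> v vp; rewrite typeB_arrangementE => -[k kroot vk].
by have [e /(_ v vp)] := open_chamber_sign p kroot; rewrite vk mulr0 ltxx.
Qed.

Lemma generic_open_chamber p y v : weyl_chamber_cone (signed p y) v ->
  ~ typeB_arrangement y v -> open_chamber p y v.
Proof.
rewrite typeB_arrangementE weyl_chamber_coneE => vp vgen i.
rewrite lt_neqAle vp andbT; apply/eqP => vi; apply: vgen.
have [k [b [kroot kE]]] := simple_root_positive p y i.
by exists k => //; move: vi; rewrite kE dotZr => /sign_mul_eq0.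
Qed.

(** The absolute values of the coordinates are sorted in decreasing order and
then all the signs are made nonpositive. *)
Lemma chambers_cover y v : exists p, weyl_chamber_cone (signed p y) v.
Proof.
pose w i := - `|dot v (y i)|; pose le_w i j := w i <= w j.
have le_w_total : total le_w by move=> i j; exact: le_total.
have le_w_trans : transitive le_w by move=> i j k; exact: le_trans.
pose r := sort le_w (enum 'I_n).
have sz : size r = n by rewrite size_sort size_enum_ord.
have /tuple_permP[s rE] : perm_eq r (ord_tuple n).
  by rewrite perm_sort val_ord_tuple.
exists ([ffun i => 0 < dot v (y (s i))], s); apply/weyl_chamber_coneP => i.
have zE j : coords (signed ([ffun i => 0 < dot v (y (s i))], s) y) v j =
    if insub j is Some j' then w (s j') else 0.
  rewrite /coords; case: insub => // j'; rewrite dotZr /= ffunE /w.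
  by case: ltrP => [/gtr0_norm|/ler0_norm] ->; rewrite ?expr1 ?expr0 ?mulN1r ?mul1r ?opprK.
rewrite !zE valK; case: insubP => [j _ jE|_]; last by rewrite oppr_le0.
have := sort_sorted le_w_total (enum 'I_n); rewrite -/r rE.
move=> /(sorted_leq_nth le_w_trans (fun i => lexx (w i)) (s i)).
move=> /(_ i j); rewrite !inE /= size_map size_enum_ord !ltn_ord jE leqnSn.
have jn : (i.+1 < n)%N by rewrite -jE ltn_ord.
rewrite !(nth_map i) -?enumT ?size_enum_ord ?ltn_ord // -jE !nth_ord_enum.
by rewrite !tnth_ord_tuple; apply=> //; rewrite jE.
Qed.

(** On the open chamber the numbers [- `|dot v (y i)|] are distinct; their order
determines the permutation, and the signs of [dot v (y i)] the sign vector. *)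
Lemma open_chamber_disjoint p q y v : open_chamber p y v -> open_chamber q y v ->
  p = q.
Proof.
pose w i := - `|dot v (y i)|; pose lt_w i j := w i < w j.
have wE p' : open_chamber p' y v ->
    forall i, w (p'.2 i) = coords (signed p' y) v i /\ p'.1 i = (0 < dot v (y (p'.2 i))).
  move=> vp' i; have := open_chamber_lt0 vp' (ltn_ord i).
  rewrite /w coords_signed; case: (p'.1 i); rewrite ?expr1 ?expr0 ?mulN1r ?mul1r => H.
    by rewrite gtr0_norm; move: H; rewrite oppr_lt0 => ->.
  by rewrite ltr0_norm // opprK ltNge (ltW H).
have sortedE p' : open_chamber p' y v -> sorted lt_w [seq p'.2 i | i <- enum 'I_n].
  move=> vp'; rewrite sorted_map.
  apply: (@sub_sorted _ (relpre val ltn)) => [i j /= ij|].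
    rewrite /lt_w !(proj1 (wE _ vp' _)).
    by apply: open_chamber_mono; rewrite ?ij ?(ltnW (ltn_ord j)).
  by rewrite -sorted_map val_enum_ord iota_ltn_sorted.
move=> vp vq.
have lt_w_trans : transitive lt_w by move=> i j k; exact: lt_trans.
have lt_w_irr : irreflexive lt_w by move=> i; exact: ltxx.
have memE (s : 'S_n) : [seq s i | i <- enum 'I_n] =i 'I_n.
  by move=> i; rewrite inE; apply/mapP; exists ((s^-1)%g i); rewrite ?mem_enum ?permKV.
have pq2 : p.2 = q.2.
  have /eq_in_map pqE := irr_sorted_eq lt_w_trans lt_w_irr (sortedE p vp) (sortedE q vq)
    (fun i => etrans (memE p.2 i) (esym (memE q.2 i))).
  by apply/permP => i; apply: pqE; rewrite mem_enum.
have pq1 : p.1 = q.1.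
  by apply/ffunP => i; rewrite (proj2 (wE _ vp i)) (proj2 (wE _ vq i)) pq2.
by case: p q pq1 pq2 {vp vq} => [? ?] [? ?] /= -> ->.
Qed.

End in_dimension_d.
End typeB_chambers.

(** * Linear dependences among the roots *)

Lemma rank_col_mx (F : fieldType) m d (k : 'rV[F]_d) (A : 'M[F]_(m, d)) :
  \rank (col_mx k A) = (\rank A + ~~ (k <= A)%MS)%N.
Proof.
have sA : (A <= col_mx k A)%MS by rewrite -addsmxE addsmxSr.
have [le_r eq_r] := mxrank_leqif_sup sA.
rewrite col_mx_sub submx_refl andbT in eq_r.
have [kA|kA] := boolP (k <= A)%MS.
  by rewrite addn0; apply/esym/eqP; rewrite eq_r.
apply/eqP; rewrite addn1 eqn_leq ltn_neqAle eq_r kA le_r !andbT.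
rewrite -addsmxE (leq_trans (mxrank_adds_leqif k A)) //.
by rewrite -[leqRHS]add1n leq_add2r rank_leq_row.
Qed.

Section flats_of_the_typeB_arrangement.
Variables (R : realType) (n : nat).

Definition std_basis (i : 'I_n) : 'rV[R]_n := delta_mx 0 i.

Definition root_rows m (A : 'M[R]_(m, n)) := forall i, row i A \in positive_roots std_basis.

Definition chamber_mx (p : chamber n) : 'M[R]_n := \matrix_i simple_root p std_basis i.

Lemma row_dot m (A : 'M[R]_(m, n)) (x : 'cV[R]_n) i :
  (A *m x) i 0 = dot x^T (row i A).
Proof. by rewrite mxE; apply: eq_bigr => k _; rewrite !mxE mulrC. Qed.

Lemma chamber_mx_inj p (u : 'cV[R]_n) : chamber_mx p *m u = 0 -> u = 0.
Proof.
move=> Du; apply/colP => j; rewrite [RHS]mxE.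
pose z := coords (signed p std_basis) u^T.
have zS (i : 'I_n) : z i = z i.+1.
  apply/eqP; rewrite -subr_eq0 -dot_simple_root.
  by have /colP/(_ i) := Du; rewrite row_dot rowK mxE => ->.
have /(_ ((p.2^-1)%g j) n) := constant_stretch (z := fun=> 0) (fun _ => lexx _)
  (fun i _ => zS i).
rewrite leqnn ltnW ?ltn_ord //= => /(_ isT erefl).
rewrite /z coords_last coords_signed permKV dot_delta mxE => /eqP.
by rewrite mulf_eq0 signr_eq0 => /eqP.
Qed.

Lemma chamber_mx_free p : row_free (chamber_mx p).
Proof.
rewrite row_free_unit -row_full_unit -sub1mx.
apply/row_subP => i; apply: submx_annihilator => u /chamber_mx_inj ->.
by rewrite mulmx0 mxE.
Qed.

(** Parabolic closure: take a point annihilated by the roots in the flat and by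
no other, and a closed chamber containing it; the simple roots of the chamber
that vanish at the point span the flat. *)
Lemma flat_simple_roots m (A : 'M[R]_(m, n)) : root_rows A ->
  exists p (J : {set 'I_n}),
    (A :=: rowsub (fun i : 'I_#|J| => enum_val i) (chamber_mx p))%MS.
Proof.
move=> Aroot.
have [s [x Ax xK]] : exists s, realizable A [seq k <- positive_roots std_basis | ~~ (k <= A)%MS] s.
  by apply: realizable_all; exact: filter_all.
have xgen k : k \in positive_roots std_basis -> dot x^T k = 0 -> (k <= A)%MS.
  move=> kroot xk; apply/negP => /negP kA.
  have : k \in [seq k <- positive_roots std_basis | ~~ (k <= A)%MS].
    by rewrite mem_filter kA.
  elim: [seq _ <- _ | _] s xK => // h K IH [|b s] //= /andP[hx Kx].
  rewrite inE => /orP[/eqP kh|/(IH _ Kx)//].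
  by move: hx; rewrite -kh row_dot row_id xk mulr0 ltxx.
have [p xp] := chambers_cover std_basis x^T.
pose J := [set i | dot x^T (simple_root p std_basis i) == 0]%SET; exists p, J.
apply/eqmxP/andP; split; apply/row_subP => i; last first.
  rewrite row_rowsub rowK; have := enum_valP i; rewrite inE => /eqP.
  have [k [b [kroot ->]]] := simple_root_positive p std_basis (enum_val i).
  rewrite dotZr => /eqP; rewrite mulf_eq0 signr_eq0 => /eqP xk.
  by apply: scalemx_sub; exact: xgen.
apply: submx_annihilator => u Bu.
rewrite row_dot row_id.
apply: (positive_root_vanish xp) (Aroot i) _ => [j xj|].
  have jJ : j \in J by rewrite inE xj.
  have /colP/(_ (enum_rank_in jJ j)) := Bu.
  by rewrite row_dot row_rowsub rowK enum_rankK_in // mxE.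
by rewrite -row_dot Ax mxE.
Qed.

Section general_position.
Variables (d : nat) (M : 'M[R]_(n, d)).
Let y i := row i M.

Lemma simple_root_rows p i : simple_root p y i = simple_root p std_basis i *m M.
Proof.
rewrite /simple_root /successive_differences /signed /signed_permutation /y.
by case: insub => [j|]; rewrite ?mulmxBl -!scalemxAl -!rowE.
Qed.

Lemma positive_roots_rows :
  positive_roots y = [seq k *m M | k <- positive_roots std_basis].
Proof.
rewrite /positive_roots map_cat -!map_comp; congr (_ ++ _).
  by apply: eq_map => i /=; rewrite -rowE.
by apply: eq_map => q /=; rewrite mulmxDl -scalemxAl -!rowE.
Qed.

Hypothesis ygen : typeB_general_position y.

Lemma general_position_rows p (f : 'I_d -> 'I_n) : injective f ->
  row_free (rowsub f (chamber_mx p *m M)).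
Proof.
move=> /(ygen.2 p.1 p.2); congr (row_free _).
apply/row_matrixP => i; rewrite rowK row_rowsub row_mul rowK -simple_root_rows.
by [].
Qed.

(** Simple roots of one chamber are independent in dimension [n], and so are up
to [d] of their images. *)
Lemma rank_root_rows m (A : 'M[R]_(m, n)) : root_rows A ->
  \rank (A *m M) = minn (\rank A) d.
Proof.
move=> /flat_simple_roots[p [J AJ]].
rewrite (eqmxMr M AJ) AJ mul_rowsub_mx.
rewrite (rank_rowsub_general ygen.1 (@general_position_rows p)); last exact: enum_val_inj.
congr minn; apply/esym/eqP.
by apply: row_free_rowsub; [exact: enum_val_inj|exact: chamber_mx_free].
Qed.

End general_position.

Lemma root_rows_col_mx m (A : 'M[R]_(m, n)) k : k \in positive_roots std_basis ->
  root_rows A -> root_rows (col_mx k A).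
Proof.
move=> kroot Aroot i; case: (split_ordP i) => j ->.
  by rewrite rowKu ord1 row_id.
by rewrite rowKd.
Qed.

(** The deletion--restriction recursion run on the roots in dimension [n]
instead of their images in dimension [d]: a flat of rank at least [d] has an
image that contains all the other roots. *)
Fixpoint generic_regions (d : nat) m (A : 'M[R]_(m, n)) (K : seq 'rV[R]_n) : nat :=
  if K is k :: K' then
    if (d <= \rank A)%N || (k <= A)%MS then 0%N
    else (generic_regions d A K' + generic_regions d (col_mx k A) K')%N
  else 1%N.

Lemma regions_generic d (M : 'M[R]_(n, d)) m (A : 'M[R]_(m, n)) K :
  typeB_general_position (fun i => row i M) ->
  root_rows A -> {subset K <= positive_roots std_basis} ->
  regions (A *m M) [seq k *m M | k <- K] = generic_regions d A K.
Proof.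
move=> ygen; elim: K m A => [|k K IH] m A Aroot Kroot /=; first exact: regions_nil.
have kroot : k \in positive_roots std_basis by apply: Kroot; rewrite mem_head.
have Kroot' : {subset K <= positive_roots std_basis}.
  by move=> h hK; apply: Kroot; rewrite inE hK orbT.
have kAroot := root_rows_col_mx kroot Aroot.
have depE : (k *m M <= A *m M)%MS = (d <= \rank A)%N || (k <= A)%MS.
  have := rank_col_mx (k *m M) (A *m M).
  rewrite -mul_col_mx !(rank_root_rows ygen) // rank_col_mx.
  case: (k <= A)%MS; case: (k *m M <= A *m M)%MS; rewrite ?orbT ?orbF //=; lia.
rewrite -depE; case: ifPn => kA; first exact: regions_cons_dep.
by rewrite regions_cons // -mul_col_mx !IH.
Qed.

End flats_of_the_typeB_arrangement.

(** * The Weyl tessellation *)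

Section topology_of_cones.
Variables (R : realType) (d : nat).
Implicit Types (v a : 'rV[R]_d).

Lemma continuous_bigsum (T : topologicalType) (I : Type) (r : seq I) (P : pred I)
    (f : I -> T -> R) :
  (forall i, continuous (f i)) -> continuous (fun x => \sum_(i <- r | P i) f i x).
Proof.
move=> fC; elim: r => [|i r IH] x.
  by under eq_fun do rewrite big_nil; exact: cvg_cst.
under eq_fun do rewrite big_cons; case: (P i); last exact: IH.
by apply: cvgD; [exact: fC|exact: IH].
Qed.

Lemma dot_continuous a : continuous (fun v : 'rV[R]_d => dot v a).
Proof.
apply: continuous_bigsum => k v.
apply: (@cvgM _ _ (nbhs v)); [exact: coord_continuous|exact: cvg_cst].
Qed.

Lemma closed_polyhedral (C : set 'rV[R]_d) : polyhedral_cone C -> closed C.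
Proof.
move=> [m [a ->]].
rewrite (_ : mkset _ = \bigcap_(i in [set: 'I_m]) (fun v => dot v (a i)) @^-1` [set t | t <= 0]).
  apply: closed_bigI => i _; apply: closed_comp; last exact: closed_le.
  by move=> v _; exact: dot_continuous.
by apply/seteqP; split=> [v vC i _|v vC i] /=; apply: vC.
Qed.

Lemma line_continuous v a : continuous (fun t : R => v + t *: a).
Proof.
by move=> t; apply: cvgD; [exact: cvg_cst|exact: scalel_continuous].
Qed.

End topology_of_cones.

Section tessellation.
Variables (R : realType) (d n : nat) (y : 'I_n -> 'rV[R]_d).
Implicit Types (v : 'rV[R]_d) (p : chamber n).

Let cone p := weyl_chamber_cone (signed p y).

Lemma open_open_chamber p : open (open_chamber p y).
Proof.
move=> v vp; apply: (filter_forall (F := nbhs v)) => i.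
have oi : open ((fun v => dot v (simple_root p y i)) @^-1` [set t | t < 0]).
  by apply: open_comp; [move=> ? _; exact: dot_continuous|exact: open_lt].
by apply: open_nbhs_nbhs; split => //; exact: vp.
Qed.

(** The strict inequalities at [u] survive in each convex combination that gives
[u] a positive weight. *)
Lemma open_chamber_segment p u v (t : R) : open_chamber p y u -> cone p v ->
  0 < t <= 1 -> open_chamber p y (v + t *: (u - v)).
Proof.
rewrite /cone weyl_chamber_coneE => up vp /andP[t0 t1] i.
have := up i; have := vp i; rewrite -/(simple_root p y i).
rewrite dotDl dotZl dotDl -scaleN1r dotZl; nra.
Qed.

(** Off the arrangement the open chamber coincides with the closed one, so it is
both open and closed there, and it is star-shaped around each of its points. *)
Lemma component_open_chamber p v : open_chamber p y v ->
  connected_component (~` typeB_arrangement y) v = open_chamber p y.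
Proof.
move=> vp; apply/seteqP; split=> [u [A [Av Agen Aconn] Au]|u up].
  suff : A `&` open_chamber p y = A by move=> e; have [] : (A `&` open_chamber p y) u by rewrite e.
  apply: Aconn; first by exists v.
    by exists (open_chamber p y) => //; exact: open_open_chamber.
  exists (cone p); first by apply: closed_polyhedral; exact: weyl_chamber_cone_polyhedral.
  apply/seteqP; split=> w [Aw wp]; split => //; first exact: open_chamber_sub.
  by apply: generic_open_chamber => //; exact: Agen.
pose f (t : R) := v + t *: (u - v).
have fsub t : `[0, 1]%classic t -> open_chamber p y (f t).
  rewrite /= in_itv /= => /andP[t0 t1]; have [->|tn0] := eqVneq t 0.
    by rewrite /f scale0r addr0.
  apply: open_chamber_segment => //; first exact: open_chamber_sub.
  by rewrite lt_neqAle eq_sym tn0 t0 t1.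
exists (f @` `[0, 1]).
  split.
  - by exists 0; rewrite /= ?in_itv /= ?lexx ?ler01 // /f scale0r addr0.
  - by move=> _ [t /fsub tp <-]; apply: open_chamber_generic tp.
  - apply: connected_continuous_connected; first exact: segment_connected.
    by apply: continuous_subspaceT; exact: line_continuous.
by exists 1; rewrite /= ?in_itv /= ?lexx ?ler01 // /f scale1r addrC subrK.
Qed.

Lemma closure_open_chamber p : open_chamber p y !=set0 ->
  closure (open_chamber p y) = cone p.
Proof.
move=> [u up]; apply/seteqP; split=> [v|v vp B].
  have /closure_id -> : closed (cone p).
    by apply: closed_polyhedral; exact: weyl_chamber_cone_polyhedral.
  by apply: closure_subset; exact: open_chamber_sub.
move=> Bv; have : nbhs (0 : R) ((fun t : R => v + t *: (u - v)) @^-1` B).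
  by apply: line_continuous; rewrite scale0r addr0.
move=> /nbhs_ballP[e /= e0 eB]; pose t := Num.min (e / 2) 1.
have t0 : 0 < t by rewrite lt_min divr_gt0 /=.
exists (v + t *: (u - v)); split.
  by apply: open_chamber_segment; rewrite // t0 /= ge_min lexx orbT.
apply: eB; rewrite /ball /= sub0r normrN gtr0_norm //.
by rewrite gt_min ltr_pdivrMr // ltr_pMr // ltr1n.
Qed.

(** A point of the open chamber is off the arrangement, so it lies in the open
chamber of any closed one that contains it. *)
Lemma cone_inj p q : open_chamber p y !=set0 -> cone p = cone q -> p = q.
Proof.
move=> [v vp] pq; apply: (@open_chamber_disjoint _ _ _ p q y v) => //.
apply: generic_open_chamber; last exact: open_chamber_generic vp.
by rewrite -/(cone q) -pq; exact: open_chamber_sub.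
Qed.

Lemma weyl_tessellationE :
  weyl_tessellation y = [set cone p | p in [set p | open_chamber p y !=set0]].
Proof.
apply/seteqP; split=> [_ [v vgen <-]|_ [p [v vp] <-]].
  have [p pv] := chambers_cover y v; have vp := generic_open_chamber pv vgen.
  have p0 : open_chamber p y !=set0 by exists v.
  by exists p => //; rewrite (component_open_chamber vp) closure_open_chamber.
exists v; first exact: open_chamber_generic vp.
by rewrite (component_open_chamber vp) closure_open_chamber //; exists v.
Qed.

Hypothesis ygen : typeB_general_position y.
Hypothesis d_gt0 : (0 < d)%N.

(** At a nonzero point of the closed cone fewer than [d] simple roots vanish, so
they are independent and the point can be moved into the open chamber. *)
Lemma open_chamber_neq0 p : (open_chamber p y !=set0) <-> (cone p <> [set 0]).
Proof.
have n_gt0 : (0 < n)%N by exact: leq_trans d_gt0 ygen.1.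
split=> [[v vp] p0|p0].
  have := open_chamber_sub vp; rewrite -/(cone p) p0 => v0.
  by have := vp (Ordinal n_gt0); rewrite v0 dot0l ltxx.
have [v [vp v0]] : exists v, cone p v /\ v != 0.
  apply: contrapT => H; apply: p0; apply/seteqP; split=> [v vp|_ ->] /=.
    by apply: contrapT => /eqP v0; apply: H; exists v.
  by rewrite /cone weyl_chamber_coneE => i; rewrite dot0l.
pose J := [set i | dot v (simple_root p y i) == 0]%SET.
pose N : 'M[R]_(n, d) := \matrix_i simple_root p y i.
have Nfree (f : 'I_d -> 'I_n) : injective f -> row_free (rowsub f N).
  move=> /(ygen.2 p.1 p.2); congr (row_free _).
  by apply/row_matrixP => i; rewrite rowK row_rowsub rowK.
pose B := rowsub (fun i : 'I_#|J| => enum_val i) N.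
have rB : \rank B = minn #|J| d by apply: rank_rowsub_general Nfree _; [exact: ygen.1|exact: enum_val_inj].
have Bv : B *m v^T = 0.
  apply/colP => i; rewrite row_dot trmxK row_rowsub rowK mxE.
  by have := enum_valP i; rewrite inE => /eqP.
have Jd : (#|J| < d)%N.
  rewrite ltnNge; apply/negP => dJ.
  have /submxP[D vE] : (v <= B)%MS by apply: submx_full; rewrite /row_full rB (minn_idPr dJ).
  have := dot_gt0 v0; suff -> : dot v v = 0 by rewrite ltxx.
  have := row_mul_colE v v^T; rewrite trmxK {1}vE -mulmxA Bv mulmx0.
  by move=> /matrixP/(_ 0 0); rewrite !mxE eqxx mulr1n => <-.
have /row_freeP[B' BB'] : row_free B by rewrite /row_free rB (minn_idPl (ltnW Jd)).
(* independence gives a direction along which the vanishing simple roots all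
   decrease at unit speed *)
pose u : 'rV[R]_d := (B' *m const_mx (- 1))^T.
have uJ i : i \in J -> dot u (simple_root p y i) = -1.
  move=> iJ; have /colP/(_ (enum_rank_in iJ i)) : B *m u^T = const_mx (-1).
    by rewrite trmxK mulmxA BB' mul1mx.
  by rewrite row_dot trmxK row_rowsub rowK enum_rankK_in // mxE.
have vlt i : i \notin J -> dot v (simple_root p y i) < 0.
  rewrite inE lt_neqAle => ->.
  by move: vp; rewrite /cone weyl_chamber_coneE => /(_ i).
have : nbhs (0 : R) [set t | forall i, i \notin J -> dot (v + t *: u) (simple_root p y i) < 0].
  apply: (filter_forall (F := nbhs (0 : R))) => i.
  have [iJ|iJ] := boolP (i \in J); first by exact: nearW.
  have : nbhs (0 : R) ((fun t : R => v + t *: u) @^-1`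
      ((fun w => dot w (simple_root p y i)) @^-1` [set t | t < 0])).
    apply: line_continuous; rewrite scale0r addr0; apply: dot_continuous.
    by apply: open_nbhs_nbhs; split; [exact: open_lt|exact: vlt].
  by apply: filterS => t /= + _.
move=> /nbhs_ballP[e /= e0 eB]; exists (v + (e / 2) *: u) => i.
have e20 : 0 < e / 2 by rewrite divr_gt0.
have [iJ|iJ] := boolP (i \in J); last first.
  apply: eB => //; rewrite /ball /= sub0r normrN gtr0_norm //.
  by rewrite ltr_pdivrMr // ltr_pMr // ltr1n.
rewrite dotDl dotZl uJ // mulrN1 subr_lt0; move: iJ; rewrite inE => /eqP ->.
exact: e20.
Qed.

Lemma has_signs_exists K (v : 'rV[R]_d) : {in K, forall k, dot v k != 0} ->
  has_signs K [seq dot v k < 0 | k <- K] v^T.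
Proof.
rewrite /has_signs; elim: K => //= k K IH vK; rewrite IH ?andbT; last first.
  by move=> h hK; apply: vK; rewrite inE hK orbT.
rewrite row_dot trmxK row_id; have := vK k (mem_head _ _).
rewrite neq_lt; case: ltP => /= vk; first by rewrite expr1 mulN1r oppr_gt0.
by rewrite expr0 mul1r.
Qed.

Lemma has_signs_unique K s (x : 'cV[R]_d) : has_signs K s x ->
  {in K, forall k, dot x^T k != 0} /\ s = [seq dot x^T k < 0 | k <- K].
Proof.
rewrite /has_signs; elim: K s => [|k K IH] [|b s] //= /andP[kx /IH[xK ->]].
move: kx; rewrite row_dot row_id => kx; split.
  move=> h; rewrite inE => /orP[/eqP->|/xK//].
  by apply: contraTN kx => /eqP ->; rewrite mulr0 ltxx.
congr (_ :: _); case: b kx; rewrite ?expr1 ?expr0 ?mul1r ?mulN1r ?oppr_gt0.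
  by move=> ->.
by move=> /ltW; rewrite leNgt => /negPf ->.
Qed.

Definition open_chambers : {set chamber n} :=
  [set p | `[< open_chamber p y !=set0 >]]%SET.

(** The sign vector of the positive roots determines the chamber because simple
roots are positive roots up to sign; conversely roots have constant signs on an
open chamber. *)
Lemma card_open_chambers_regions :
  #|open_chambers| = regions (0 : 'M[R]_(0, d)) (positive_roots y).
Proof.
set K := positive_roots y.
pose sgn v := [seq dot v k < 0 | k <- K].
pose pt p := xget 0 (open_chamber p y).
have ptP p : p \in open_chambers -> open_chamber p y (pt p).
  by rewrite inE => /asboolP; exact: xgetPex.
have genP v : ~ typeB_arrangement y v <-> {in K, forall k, dot v k != 0}.
  rewrite typeB_arrangementE; split=> [vgen k kK|vK [k /vK /eqP]] //.
  by apply/eqP => vk; apply: vgen; exists k.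
have sgnE p v w : open_chamber p y v -> open_chamber p y w -> sgn v = sgn w.
  move=> vp wp; apply/eq_in_map => k /(open_chamber_sign p)[e].
  move=> H; have := H v vp; have := H w wp.
  case: e {H}; rewrite ?expr1 ?expr0 ?mul1r ?mulN1r ?oppr_gt0; first by move=> -> ->.
  by move=> /ltW + /ltW; rewrite !leNgt => /negPf -> /negPf ->.
have sgn_open p v w : open_chamber p y v -> ~ typeB_arrangement y w ->
    sgn v = sgn w -> open_chamber p y w.
  move=> vp wgen /eq_in_map vw i; have := vp i.
  have [k [b [kK ->]]] := simple_root_positive p y i; rewrite !dotZr.
  have := vw _ kK; have := (genP w).1 wgen k kK.
  case: b; rewrite ?expr1 ?expr0 ?mul1r ?mulN1r ?oppr_lt0; last by move=> _ ->.
  rewrite neq_lt => /orP[wk|-> //]; rewrite wk => /ltW; rewrite leNgt.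
  by move=> /negPf ->.
have realP s : realizable (0 : 'M[R]_(0, d)) K s <->
    exists2 v, ~ typeB_arrangement y v & s = sgn v.
  split=> [[x _ /has_signs_unique[/genP xgen ->]]|[v /genP vgen ->]].
    by exists x^T.
  by exists v^T; [rewrite mul0mx|exact: has_signs_exists].
rewrite /regions -size_filter cardE -(size_map (sgn \o pt) (enum _)).
apply/perm_size/uniq_perm.
- rewrite map_inj_in_uniq ?enum_uniq // => p q; rewrite !mem_enum => /ptP pp /ptP qq.
  move=> /(sgn_open _ _ _ pp (open_chamber_generic qq)).
  by move=> pq; exact: open_chamber_disjoint pq qq.
- exact/filter_uniq/bitseqs_uniq.
move=> s; rewrite mem_filter; apply/mapP/andP => [[p]|[/asboolP/realP[v vgen ->] _]].
  rewrite mem_enum => /ptP pp ->; split.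
    by apply/asboolP/realP; exists (pt p) => //; exact: open_chamber_generic pp.
  by rewrite -(size_map (fun k => dot (pt p) k < 0) K) mem_bitseqs.
have [p /generic_open_chamber/(_ vgen) vp] := chambers_cover y v.
have pS : p \in open_chambers by rewrite inE; apply/asboolP; exists v.
by exists p; rewrite ?mem_enum //; apply: sgnE vp (ptP _ pS).
Qed.

Lemma card_open_chambers :
  #|open_chambers| = generic_regions d (0 : 'M[R]_(0, n)) (positive_roots (@std_basis R n)).
Proof.
pose M : 'M[R]_(n, d) := \matrix_i y i.
have yM : y = fun i => row i M by apply/funext => i; rewrite rowK.
rewrite card_open_chambers_regions yM positive_roots_rows.
rewrite -(mul0mx 0 M) regions_generic //; first by rewrite -yM.
by case.
Qed.

End tessellation.

(** * Borel sets of cones *)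

Section rational_boxes.
Variables (R : realType) (d : nat).
Implicit Types (v : 'rV[R]_d) (G : set 'rV[R]_d).

Definition box (c : 'rV[R]_d) (r : R) : set 'rV[R]_d :=
  [set v | forall k, `|v 0 k - c 0 k| <= r].

Definition qvec (q : 'rV[rat]_d) : 'rV[R]_d := map_mx ratr q.

Definition qbox (b : 'rV[rat]_d * rat) : set 'rV[R]_d := box (qvec b.1) (ratr b.2).

Lemma box_compact c r : compact (box c r).
Proof.
have -> : box c r = [set v | forall k, `[c 0 k - r, c 0 k + r]%classic (v ord0 k)].
  apply/seteqP; split=> v vb k; have := vb k; rewrite /= in_itv /= ler_distl;
  by rewrite [X in _ && (_ <= X)]addrC.
apply: (@rV_compact R d (fun k => `[c 0 k - r, c 0 k + r]%classic)) => k.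
exact: segment_compact.
Qed.

Lemma qvec_near v (e : R) : 0 < e -> exists q, forall k, `|v 0 k - qvec q 0 k| < e.
Proof.
move=> e0.
have /choice[q qP] k : exists q : rat, ratr q \in `](v 0 k - e), (v 0 k + e)[.
  by apply: rat_in_itvoo; move: e0; lra.
exists (\row_k q k) => k; rewrite !mxE; have := qP k.
by rewrite in_itv /= distrC ltr_distl.
Qed.

Lemma qvec_dense v G : nbhs v G -> exists q, G (qvec q).
Proof.
move=> /nbhs_ballP[e /= e0 eG]; have [q qv] := qvec_near v e0.
by exists q; apply: eG; split=> // i k; rewrite ord1 /ball /=; exact: qv.
Qed.

Lemma qbox_nbhs v G : nbhs v G -> exists b, nbhs v (qbox b) /\ qbox b `<=` G.
Proof.
move=> /nbhs_ballP[e /= e0 eG].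
have [r /andP[r0 re]] : exists r : rat, (0 < ratr r :> R) && (ratr r < e / 2 :> R).
  have [|r] := @rat_in_itvoo R 0 (e / 2); first by rewrite divr_gt0.
  by rewrite in_itv /= => rP; exists r.
have [|q qv] := @qvec_near v (ratr r / 2); first by rewrite divr_gt0.
exists (q, r); split.
  apply/nbhs_ballP; exists (ratr r / 2); first by rewrite /= divr_gt0.
  move=> w [_ vw] k; have := vw ord0 k; have := qv k; rewrite /ball /=.
  rewrite !ltr_distl => /andP[? ?] /andP[? ?]; rewrite ler_distl; apply/andP; lra.
move=> w wb; apply: eG; split=> // i k; rewrite ord1 /ball /=.
have := wb k; have := qv k; rewrite /= ltr_distl ler_distl => /andP[? ?] /andP[? ?].
rewrite ltr_distl; apply/andP; lra.
Qed.

End rational_boxes.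

Section borel_sets_of_cones.
Variables (R : realType) (d : nat).

(** Although [hit_miss l] is in general not open, since the boxes are closed, the
countably many sets of this form refine the Fell topology at closed sets. *)
Definition hit_miss (l : seq ('rV[rat]_d * rat) * seq ('rV[rat]_d * rat)) :
    set (set 'rV[R]_d) :=
  [set F | {in l.1, forall b, F `&` qbox b !=set0} /\
           {in l.2, forall b, F `&` qbox b = set0}].

(** A box around a common point of [F] and the open set is hit only together with
the open set; the compact set is covered by finitely many boxes that miss [F]. *)
Lemma fell_subbase_hit_miss S (F : set 'rV[R]_d) : closed F ->
  fell_subbase S -> S F -> exists l, hit_miss l F /\ hit_miss l `<=` S.
Proof.
move=> Fcl [[G Gop <-] /= [v [Fv Gv]]|[K Kco <-] /= FK].
  have [|b [vb bG]] := @qbox_nbhs _ _ v G; first exact: open_nbhs_nbhs.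
  exists ([:: b], [::]); split.
    split=> // b'; rewrite inE => /eqP ->; exists v; split=> //.
    exact: nbhs_singleton vb.
  move=> F' [/(_ b (mem_head _ _))[w [F'w bw]] _]; exists w; split=> //.
  exact: bG.
move: Kco; rewrite compact_cover => Kco.
have [] := Kco _ [set b | qbox b `<=` ~` F] (fun b => (qbox b)^°).
- by move=> b _; exact: open_interior.
- move=> v Kv; have : nbhs v (~` F).
    apply: open_nbhs_nbhs; split; first exact: closed_openC.
    by move=> Fv; have : (F `&` K) v by []; rewrite FK.
  by move=> /qbox_nbhs[b [vb bF]]; exists b.
move=> D DF KD; exists ([::], finmap.enum_fset D); split.
  split=> // b bD; have bF := set_mem (DF b bD).
  by apply/seteqP; split=> // v [Fv /bF].
move=> F' [_ F'D] /=; apply/seteqP; split=> // v [F'v /KD[b bD vb]].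
by rewrite -(F'D b bD); split=> //; exact: interior_subset vb.
Qed.

Lemma fell_open_hit_miss (U : set (fell_space R d)) (F : set 'rV[R]_d) : closed F ->
  open U -> U F -> exists l, hit_miss l F /\ hit_miss l `<=` U.
Proof.
move=> Fcl [D' D'sub <-] [B D'B].
have [D Dsub DE] := D'sub _ D'B; rewrite -DE => DF.
have HD S : S \in finmap.enum_fset D -> fell_subbase S /\ S F.
  by move=> SD; split; [exact: set_mem (Dsub S SD)|exact: DF].
suff [l [lF lD]] : exists l, hit_miss l F /\
    forall S, S \in finmap.enum_fset D -> hit_miss l `<=` S.
  exists l; split=> // F' F'l; exists B => //.
  by suff : B F' by []; rewrite -DE => S SD; exact: lD F'l.
elim: (finmap.enum_fset D) HD => [|S s IH] HD; first by exists ([::], [::]).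
have [|l [lF ls]] := IH; first by move=> S' S's; apply: HD; rewrite inE S's orbT.
have [SS SF] := HD S (mem_head _ _).
have [l' [l'F l'S]] := fell_subbase_hit_miss Fcl SS SF.
exists (l'.1 ++ l.1, l'.2 ++ l.2); split.
  split=> b /=; rewrite mem_cat => /orP[];
    by [apply l'F.1|apply lF.1|apply l'F.2|apply lF.2].
move=> S' + F' [F'1 F'2]; rewrite inE => /orP[/eqP ->|S's].
  by apply: l'S; split=> b bl; [apply: F'1|apply: F'2]; rewrite mem_cat bl.
by apply: (ls _ S's); split=> b bl; [apply: F'1|apply: F'2]; rewrite mem_cat bl orbT.
Qed.

(** Second countability makes an open set of cones a countable union of sets
[hit_miss l], so the events of hitting a box suffice. *)
Lemma measurable_random_cone (disp : measure_display) (T : measurableType disp)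
    (X : T -> set 'rV[R]_d) :
  (forall t, polyhedral_cone (X t)) ->
  (forall b, measurable [set t | X t `&` qbox b !=set0]) ->
  forall B, borel_cones B -> measurable (X @^-1` B).
Proof.
move=> Xpoly Xbox.
have mhit l : measurable [set t | hit_miss l (X t)].
  have mseq (s : seq ('rV[rat]_d * rat)) (A : _ -> set T) :
      (forall b, measurable (A b)) -> measurable [set t | {in s, forall b, A b t}].
    move=> mA; elim: s => [|b s IH].
      by rewrite (_ : mkset _ = setT) //; apply/seteqP; split.
    rewrite (_ : mkset _ = A b `&` [set t | {in s, forall b, A b t}]).
      exact: measurableI.
    apply/seteqP; split=> [t H|t [At H] b'].
      split; first by apply: H; exact: mem_head.
      by move=> b' b's; apply: H; rewrite inE b's orbT.
    by rewrite inE => /orP[/eqP ->//|]; exact: H.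
  apply: measurableI.
    exact: (mseq l.1 (fun b => [set t | X t `&` qbox b !=set0])).
  apply: (mseq l.2 (fun b => [set t | X t `&` qbox b = set0])) => b.
  rewrite (_ : mkset _ = ~` [set t | X t `&` qbox b !=set0]).
    exact: measurableC.
  apply/seteqP; split=> t /=; first by move=> -> [].
  by move=> H; apply/eqP/negP => /negP /set0P.
apply: smallest_sub => [|_ [U Uop <-]].
  split=> [|A mA|A mA].
  - by rewrite preimage_set0.
  - rewrite (_ : _ @^-1` _ = ~` (X @^-1` A)); first exact: measurableC.
    by apply/seteqP; split=> [t []//|t At]; split=> //; exact: Xpoly.
  - by rewrite preimage_bigcup; exact: bigcupT_measurable.
rewrite (_ : _ @^-1` _ = \bigcup_l
    (if `[< hit_miss l `<=` U >] then [set t | hit_miss l (X t)] else set0)).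
  apply: countable_bigcupT_measurable => [|l]; first exact: countableP.
  by case: ifP.
apply/seteqP; split=> [t [UX _]|t [l _]].
  have [l [lX lU]] := fell_open_hit_miss (closed_polyhedral (Xpoly t)) Uop UX.
  by exists l => //; rewrite asboolT.
by case: asboolP => // lU lX; split; [exact: lU|exact: Xpoly].
Qed.

End borel_sets_of_cones.

(** * Measurability of the random cones *)

Section measurable_projection.
Variables (disp : measure_display) (T : measurableType disp) (R : realType).

Lemma measurable_lt_const (f : T -> R) (c : R) : measurable_fun setT f ->
  measurable [set t | f t < c].
Proof.
move=> mf; have := mf measurableT `]-oo, c[%classic (measurable_itv _).
by rewrite setTI; congr measurable.
Qed.

(** Projection along a compact set: for [g] continuous in its second argument
the existential quantifier can be restricted to rational points close to the
compact set, at the price of a tolerance that tends to zero. *)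
Lemma measurable_exists_compact m (C : set 'rV[R]_m) (g : T -> 'rV[R]_m -> R) :
  compact C ->
  (forall t, continuous (g t)) -> (forall u, measurable_fun setT (g^~ u)) ->
  measurable [set t | exists2 u, C u & g t u <= 0].
Proof.
move=> Cco gcont gmeas.
pose near_C k (q : 'rV[rat]_m) := exists2 c, C c & ball c (k.+1%:R^-1 : R) (qvec R q).
rewrite (_ : mkset _ = \bigcap_k \bigcup_q
    (if `[< near_C k q >] then [set t | g t (qvec R q) < k.+1%:R^-1] else set0)).
  apply: bigcap_measurableType => k _.
  apply: countable_bigcupT_measurable => [|q]; first exact: countableP.
  by case: ifP => // _; apply: measurable_lt_const.
apply/seteqP; split=> [t [u Cu gu] k _|t tP].
  have k0 : 0 < (k.+1%:R^-1 : R) by rewrite invr_gt0.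
  have nlt : nbhs u (g t @^-1` [set x | x < k.+1%:R^-1]).
    apply: gcont; apply: open_nbhs_nbhs; split; first exact: open_lt.
    exact: le_lt_trans gu k0.
  have [q [qlt qu]] := qvec_dense (filterI nlt (nbhsx_ballx u _ k0)).
  by exists q => //; rewrite asboolT //; exists u.
have /choice[f fP] k : exists cq : 'rV[R]_m * 'rV[rat]_m,
    [/\ C cq.1, ball cq.1 (k.+1%:R^-1 : R) (qvec R cq.2) & g t (qvec R cq.2) < k.+1%:R^-1].
  have [q _] := tP k I; case: asboolP => // -[c Cc cq] gq.
  by exists (c, q).
have [|u [Cu uF]] := Cco ((fun k => (f k).1) @ \oo) _.
  by exists 0%N => // k _; have [] := fP k.
exists u => //; rewrite leNgt; apply/negP => gu.
have : nbhs u (g t @^-1` [set x | g t u / 2 < x]).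
  apply: gcont; apply: open_nbhs_nbhs; split; first exact: open_gt.
  by rewrite /= ltr_pdivrMr // ltr_pMr // ltr1n.
move=> /nbhs_ballP[e /= e0 eg].
(* beyond some index both the distance to the compact set and the tolerance are
   too small for the value [g t u] at the cluster point [u] *)
have tail : ((fun k => (f k).1) @ \oo)
    [set c | exists k, c = (f k).1 /\ (k.+1%:R^-1 : R) < Num.min (e / 2) (g t u / 2)].
  have m0 : 0 < Num.min (e / 2) (g t u / 2) by rewrite lt_min !divr_gt0.
  by apply: filterS (near_infty_natSinv_lt (PosNum m0)) => k kk; exists k.
have e20 : 0 < e / 2 by rewrite divr_gt0.
have [_ [[k [-> ]]]] := uF _ _ tail (nbhsx_ballx u _ e20).
rewrite lt_min => /andP[ke kg] uk; have [_ kq gq] := fP k.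
have : g t u / 2 < g t (qvec R (f k).2).
  apply: eg; rewrite [e]splitr; apply: ball_triangle uk _.
  by apply: le_ball kq; exact: ltW.
by rewrite ltNge (le_trans (ltW gq) (ltW kg)).
Qed.

End measurable_projection.

Section measurable_cones.
Variables (R : realType) (d n : nat).
Local Notation tup := (n.-tuple (euclidean_space R d)).

Definition tuple_vectors (t : tup) : 'I_n -> 'rV[R]_d := fun i => tnth t i.

Lemma measurable_coord k :
  measurable_fun setT (fun v : euclidean_space R d => (v : 'rV[R]_d) 0 k).
Proof.
apply: (measurability _ (RGenOInfty.measurableE R)) => _ [_ [a ->] <-].
rewrite setTI; apply: sub_sigma_algebra.
have : open ((fun v : 'rV[R]_d => v 0 k) @^-1` [set x | a < x]).
  by apply: open_comp; [move=> v _; exact: coord_continuous|exact: open_gt].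
congr open; apply/seteqP; split=> v /=; by rewrite in_itv /= andbT.
Qed.

Lemma measurable_tuple_coord i k :
  measurable_fun setT (fun t : tup => tuple_vectors t i 0 k).
Proof.
by apply: (measurableT_comp (measurable_coord k)); exact: measurable_tnth.
Qed.

Lemma measurable_differences i k :
  measurable_fun setT (fun t : tup => successive_differences (tuple_vectors t) i 0 k).
Proof.
rewrite /successive_differences; case: insub => [j|]; last exact: measurable_tuple_coord.
under eq_fun do rewrite !mxE.
by apply: measurable_funB; exact: measurable_tuple_coord.
Qed.

(** Twice the positive part: a finite system of inequalities is encoded by one
nonpositive sum of these. *)
Definition excess (x : R) : R := `|x| + x.

Lemma excess_ge0 x : 0 <= excess x.
Proof. by rewrite /excess -lerBlDr sub0r -normrN ler_norm. Qed.

Lemma excess_le0 x : (excess x <= 0) = (x <= 0).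
Proof.
rewrite /excess; have [x0|x0] := leP x 0; first by rewrite ler0_norm // addNr lexx.
by apply/negbTE; rewrite -ltNge gtr0_norm // addr_gt0.
Qed.

Lemma excess_continuous (U : topologicalType) (f : U -> R) :
  continuous f -> continuous (fun u => excess (f u)).
Proof. by move=> fC u; apply: cvgD; [apply: cvg_norm|]; exact: fC. Qed.

Lemma measurable_excess (disp : measure_display) (T : measurableType disp)
    (f : T -> R) :
  measurable_fun setT f -> measurable_fun setT (fun t => excess (f t)).
Proof.
move=> mf; apply: measurable_funD => //.
exact: (measurableT_comp (@normr_measurable R setT)).
Qed.

Lemma sum_excess_le0 (I : finType) (f : I -> R) :
  (\sum_i excess (f i) <= 0) <-> forall i, f i <= 0.
Proof.
split=> [le0 i|f0]; last by rewrite sumr_le0 // => i _; rewrite excess_le0.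
rewrite -excess_le0 (le_trans _ le0) // (bigD1 i) //= lerDl sumr_ge0 // => j _.
exact: excess_ge0.
Qed.

Lemma measurable_chamber_box b :
  measurable [set t : tup | weyl_chamber_cone (tuple_vectors t) `&` qbox b !=set0].
Proof.
pose g (t : tup) (v : 'rV[R]_d) :=
  \sum_i excess (dot v (successive_differences (tuple_vectors t) i)).
rewrite (_ : mkset _ = [set t | exists2 v, qbox b v & g t v <= 0]).
  apply: measurable_exists_compact => [|t|v].
  - exact: box_compact.
  - by apply: continuous_bigsum => i; apply: excess_continuous; exact: dot_continuous.
  - apply: measurable_sum => i; apply: measurable_excess.
    apply: measurable_sum => k; apply: measurable_funM => //.
    exact: measurable_differences.
apply/seteqP; split=> t [v]; rewrite ?weyl_chamber_coneE.
  by move=> [vt vb]; exists v => //; apply/sum_excess_le0.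
by move=> vb /sum_excess_le0 vt; exists v; rewrite weyl_chamber_coneE.
Qed.

(** The coefficients of a positive combination range over a set that is not
compact, but it is exhausted by boxes. *)
Lemma measurable_hull_box b :
  measurable [set t : tup |
    pos_hull (successive_differences (tuple_vectors t)) `&` qbox b !=set0].
Proof.
pose x (t : tup) (l : 'rV[R]_n) k :=
  \sum_i l 0 i * successive_differences (tuple_vectors t) i 0 k.
pose g (t : tup) (l : 'rV[R]_n) := \sum_i excess (- l 0 i) +
  \sum_k excess (`|x t l k - qvec R b.1 0 k| - ratr b.2).
have gP t l : g t l <= 0 <-> (forall i, 0 <= l 0 i) /\
    (forall k, `|x t l k - qvec R b.1 0 k| <= ratr b.2).
  have s1 : 0 <= \sum_i excess (- l 0 i) by apply: sumr_ge0 => i _; exact: excess_ge0.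
  have s2 : 0 <= \sum_k excess (`|x t l k - qvec R b.1 0 k| - ratr b.2).
    by apply: sumr_ge0 => i _; exact: excess_ge0.
  split=> [gt|[l0 lb]].
    have /sum_excess_le0 l0 : \sum_i excess (- l 0 i) <= 0.
      by rewrite (le_trans _ gt) // lerDl.
    have /sum_excess_le0 lb : \sum_k excess (`|x t l k - qvec R b.1 0 k| - ratr b.2) <= 0.
      by rewrite (le_trans _ gt) // lerDr.
    by split=> [i|k]; [rewrite -oppr_le0|rewrite -subr_le0].
  rewrite /g -[leRHS]addr0 lerD //; apply/sum_excess_le0 => i.
    by rewrite oppr_le0.
  by rewrite subr_le0.
rewrite (_ : mkset _ = \bigcup_N [set t | exists2 l, box 0 (N%:R : R) l & g t l <= 0]).
  apply: bigcupT_measurable => N; apply: measurable_exists_compact => [|t|l].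
  - exact: box_compact.
  - move=> l; apply: (@cvgD _ _ _ (nbhs l)).
      apply: (continuous_bigsum (f := fun i (l : 'rV[R]_n) => excess (- l 0 i))) => i.
      apply: excess_continuous => {}l.
      by apply: (@cvgN _ _ _ (nbhs l)); exact: coord_continuous.
    apply: (continuous_bigsum (f := fun k (l : 'rV[R]_n) =>
      excess (`|x t l k - qvec R b.1 0 k| - ratr b.2))) => k.
    apply: excess_continuous => {}l.
    apply: (@cvgB _ _ _ (nbhs l)); last exact: cvg_cst.
    apply: (@cvg_norm _ _ _ (nbhs l)).
    apply: (@cvgB _ _ _ (nbhs l)); last exact: cvg_cst.
    apply: (continuous_bigsum (f := fun i (l : 'rV[R]_n) =>
      l 0 i * successive_differences (tuple_vectors t) i 0 k)) => i {}l.
    by apply: (@cvgM _ _ (nbhs l)); [exact: coord_continuous|exact: cvg_cst].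
  - apply: measurable_funD; apply: measurable_sum => i; apply: measurable_excess => //.
    apply: measurable_funB => //; apply: measurableT_comp => //.
    apply: measurable_funB => //; apply: measurable_sum => j.
    by apply: measurable_funM => //; exact: measurable_differences.
have xE t (l : 'rV[R]_n) k :
    (\sum_i l 0 i *: successive_differences (tuple_vectors t) i) 0 k = x t l k.
  by rewrite summxE; apply: eq_bigr => i _; rewrite mxE.
apply/seteqP; split=> [t [_ [[l l0 ->] lb]]|t [N _ [l _ /gP[l0 lb]]]].
  pose r := \row_i l i.
  have rE : \sum_i l i *: successive_differences (tuple_vectors t) i =
    \sum_i r 0 i *: successive_differences (tuple_vectors t) i.
    by apply: eq_bigr => i _; rewrite mxE.
  exists (Num.truncn (\sum_i l i)).+1 => //; exists r.
    move=> i; rewrite !mxE subr0 ger0_norm //.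
    apply: le_trans (ltW (truncnS_gt _)).
    by rewrite (bigD1 i) //= lerDl sumr_ge0.
  apply/gP; split=> [i|k]; first by rewrite mxE.
  by rewrite -xE -rE; exact: lb.
exists (\sum_i l 0 i *: successive_differences (tuple_vectors t) i); split.
  by exists (fun i => l 0 i).
by move=> k; rewrite xE.
Qed.

Lemma measurable_chamber_cone B : borel_cones B ->
  measurable [set t : tup | B (weyl_chamber_cone (tuple_vectors t))].
Proof.
apply: measurable_random_cone => [t|b]; first exact: weyl_chamber_cone_polyhedral.
exact: measurable_chamber_box.
Qed.

Lemma measurable_pos_hull B : borel_cones B ->
  measurable [set t : tup |
    B (pos_hull (successive_differences (tuple_vectors t)))].
Proof.
apply: (measurable_random_cone (X := fun t : tup =>
  pos_hull (successive_differences (tuple_vectors t)))) => [t|b].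
  exact: pos_hull_polyhedral.
exact: measurable_hull_box.
Qed.

(** The complement of the origin is a countable union of rational boxes. *)
Lemma measurable_chamber_neq0 :
  measurable [set t : tup | weyl_chamber_cone (tuple_vectors t) <> [set 0]].
Proof.
rewrite (_ : mkset _ = \bigcup_b
   (if `[< qbox b `<=` ~` [set (0 : 'rV[R]_d)] >] then
      [set t | weyl_chamber_cone (tuple_vectors t) `&` qbox b !=set0] else set0)).
  apply: countable_bigcupT_measurable => [|b]; first exact: countableP.
  by case: ifP => // _; exact: measurable_chamber_box.
apply/seteqP; split=> [t t0|t [b _]].
  have [v [vt v0]] : exists v, weyl_chamber_cone (tuple_vectors t) v /\ v <> 0.
    apply: contrapT => H; apply: t0; apply/seteqP; split=> [v vt|_ ->] /=.
      by apply: contrapT => v0; apply: H; exists v.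
    by rewrite weyl_chamber_coneE => i; rewrite dot0l.
  have [|b [vb b0]] := @qbox_nbhs _ _ v (~` [set 0]).
    apply: open_nbhs_nbhs; split=> //; apply: closed_openC.
    have [s <-] := halfspaces_zero R d.
    by apply: closed_polyhedral; exact: polyhedral_halfspaces.
  exists b => //; rewrite asboolT //; exists v; split=> //.
  exact: nbhs_singleton vb.
by case: asboolP => // b0 [v [vt /b0 v0]] t0; apply: v0; rewrite -t0.
Qed.

End measurable_cones.

(** * Integration and uniform choice *)

Section lower_integral.
Context (disp : measure_display) (T : measurableType disp) (R : realType).
Variable mu : {measure set T -> \bar R}.
Import HBNNSimple.

(** The integral of a nonnegative function is a supremum over the simple
functions below it, whether or not it is measurable; a simple function may be
replaced by zero on a null set. *)
Lemma ge0_integral_eq_outside_null (N : set T) (f g : T -> \bar R) :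
  measurable N -> mu N = 0%E ->
  (forall x, 0 <= f x)%E -> (forall x, 0 <= g x)%E ->
  (forall x, ~ N x -> f x = g x) -> (\int[mu]_x f x = \int[mu]_x g x)%E.
Proof.
move=> mN N0.
have le_int (f' g' : T -> \bar R) : (forall x, 0 <= f' x)%E ->
    (forall x, 0 <= g' x)%E -> (forall x, ~ N x -> f' x = g' x) ->
    (\int[mu]_x f' x <= \int[mu]_x g' x)%E.
  move=> f0 g0 fg; rewrite !ge0_integralTE //.
  apply: ge_ereal_sup => _ [h /= hf <-].
  have mNC := measurableC mN.
  pose h' := proj_nnsfun h mNC.
  have hE : sintegral mu h = sintegral mu h'.
    rewrite -!integralT_nnsfun; apply: ge0_ae_eq_integral => //.
    - by apply/measurable_EFinP; exact: measurable_funPT.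
    - by apply/measurable_EFinP; exact: measurable_funPT.
    - by move=> x _; rewrite lee_fin; exact: fun_ge0.
    - by move=> x _; rewrite lee_fin; exact: fun_ge0.
    exists N; split=> // x /= /not_implyP[_ hh']; apply: contrapT => Nx; apply: hh'.
    by rewrite /h' /= mindicE mem_set // mulr1.
  rewrite hE; apply: ereal_sup_ubound; exists h' => //= x.
  rewrite mindicE; have [Nx|Nx] := pselect (N x).
    by rewrite memNset ?mulr0 //; apply.
  by rewrite mem_set // mulr1 -fg.
move=> f0 g0 fg; apply/eqP; rewrite eq_le !le_int //.
by move=> x /fg.
Qed.

End lower_integral.

Section uniform.
Variable R : realType.

Lemma uniform_law_image (I : choiceType) (J : finType) (S : {set J}) (f : J -> I) B :
  {in S &, injective f} ->
  uniform_law R [set f p | p in [set` S]] B =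
  (#|S|%:R)^-1 * \sum_(p in S) (\1_B (f p) : R).
Proof.
move=> fI; rewrite /uniform_law; set W := [set f p | p in _].
have Wfin : finite_set W by apply: finite_image; exact: finite_finset.
have WS : perm_eq (enum_fset (fset_set W)) (map f (enum S)).
  apply: uniq_perm; first exact: fset_uniq.
    by rewrite map_inj_in_uniq ?enum_uniq // => p q; rewrite !mem_enum; exact: fI.
  move=> C; apply/idP/mapP => [|[p pS ->]].
    move=> H; have : C \in fset_set W by []; rewrite in_fset_set // => /set_mem[p pS <-].
    by exists p; rewrite ?mem_enum.
  suff : f p \in fset_set W by [].
  by rewrite in_fset_set //; apply/mem_set; exists p => //; rewrite mem_enum in pS.
rewrite fsbig_finite // (perm_big _ WS) big_map big_enum /=.
by rewrite (perm_size WS) size_map -cardE.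
Qed.

End uniform.

(** * The law of the Weyl random cone *)

Section random_weyl_cones.
Context (disp : measure_display) (T : measurableType disp) (R : realType).
Variables (P : probability T R) (d n : nat).
Variable Y : 'I_n -> {RV P >-> euclidean_space R d}.
Local Notation tup := (n.-tuple (euclidean_space R d)).
Let y w : 'I_n -> 'rV[R]_d := fun i => Y i w.

Definition chamber_tuple (p : chamber n) (w : T) : tup :=
  [tuple (signed p (y w) i : euclidean_space R d) | i < n].

Lemma measurable_sign (e : bool) : measurable_fun setT
  (fun v : euclidean_space R d => (-1) ^+ e *: (v : 'rV[R]_d) : euclidean_space R d).
Proof.
apply: (@measurability _ _ _ (euclidean_space R d) _ _ (@open 'rV[R]_d)) => // _ [G Gop <-].
rewrite setTI; apply: sub_sigma_algebra.
apply: (@open_comp 'rV[R]_d 'rV[R]_d (fun v => (-1) ^+ e *: v)) => // v _.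
exact: scaler_continuous.
Qed.

Lemma measurable_chamber_tuple p : measurable_fun setT (chamber_tuple p).
Proof.
apply/measurable_fun_tnthP => i.
rewrite (_ : _ \o _ = (fun v : euclidean_space R d =>
    (-1) ^+ p.1 i *: (v : 'rV[R]_d) : euclidean_space R d) \o Y (p.2 i)); last first.
  by apply/funext => w /=; rewrite tnth_mktuple.
by apply: (measurableT_comp (measurable_sign _)); exact: measurable_funPT.
Qed.

Lemma tuple_vectors_chamber p w : tuple_vectors (chamber_tuple p w) = signed p (y w).
Proof. by apply/funext => i; rewrite /tuple_vectors tnth_mktuple. Qed.

Hypothesis Yexch : symmetrically_exchangeable P Y.

Lemma chamber_event p (A : set tup) : measurable A ->
  P [set w | A (chamber_tuple p w)] =
  P [set w | A [tuple (Y i w : euclidean_space R d) | i < n]].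
Proof. by move=> /(Yexch p.1 p.2) ->. Qed.

Hypothesis d_gt0 : (0 < d)%N.
Hypothesis Ygen : {ae P, forall w, typeB_general_position (y w)}.

Let ncones : nat := generic_regions d (0 : 'M[R]_(0, n)) (positive_roots (@std_basis R n)).

Definition cone_event (B : set (set 'rV[R]_d)) : set tup :=
  [set t | B (weyl_chamber_cone (tuple_vectors t)) /\
           weyl_chamber_cone (tuple_vectors t) <> [set 0]].

Definition chambers_in B w : R :=
  \sum_(p : chamber n) \1_(cone_event B) (chamber_tuple p w).

(** By exchangeability each signed permutation contributes the same
probability. *)
Lemma integral_chambers_in B : measurable (cone_event B) ->
  (\int[P]_w (chambers_in B w)%:E)%E =
  (#|{: chamber n}|%:R * fine (P [set w | B (weyl_chamber_cone (y w)) /\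
                              weyl_chamber_cone (y w) <> [set 0]]))%:E.
Proof.
move=> mB; set E := [set w | _].
have mpre p : measurable [set w | cone_event B (chamber_tuple p w)].
  have := measurable_chamber_tuple p measurableT mB.
  by rewrite setTI.
have PE p : P [set w | cone_event B (chamber_tuple p w)] = P E.
  rewrite chamber_event //; congr (P _); apply/funext => w /=.
  rewrite /cone_event /= (_ : tuple_vectors _ = y w) //.
  by apply/funext => i; rewrite /tuple_vectors tnth_mktuple.
rewrite /chambers_in; under eq_integral do rewrite -sumEFin.
rewrite ge0_integral_sum //=; last first.
  by move=> p; apply/measurable_EFinP; exact: measurable_indic (mpre p).
rewrite (eq_bigr (fun=> P E)) => [|p _]; last first.
  have := integral_indic P measurableT (mpre p).
  by move=> H; rewrite -(PE p); apply: etrans H _; rewrite setIT.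
have PEfin : P E \is a fin_num 
  by rewrite -(PE ([ffun=> false], 1%g)); exact: fin_num_measure.
by rewrite -(fineK PEfin) sumEFin sumr_const mulr_natl.
Qed.

Lemma chambers_in_generic B w : typeB_general_position (y w) ->
  chambers_in B w = \sum_(p in open_chambers (y w)) \1_B (weyl_chamber_cone (signed p (y w))).
Proof.
move=> ygen; rewrite /chambers_in [RHS]big_mkcond; apply: eq_bigr => p _.
have -> : (p \in open_chambers (y w)) = `[< weyl_chamber_cone (signed p (y w)) <> [set 0] >].
  by rewrite inE; apply: asbool_equiv_eq; exact: open_chamber_neq0.
rewrite indicE (_ : (_ \in _) = `[< cone_event B (chamber_tuple p w) >]).
  rewrite /cone_event /= tuple_vectors_chamber asbool_and indicE.
  rewrite (_ : (_ \in B) = `[< B (weyl_chamber_cone (signed p (y w))) >]) //.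
  by case: (`[< _ <> _ >]); rewrite ?andbT ?andbF.
by [].
Qed.

Lemma uniform_law_generic B w : typeB_general_position (y w) ->
  uniform_law R (weyl_tessellation (y w)) B = ncones%:R^-1 * chambers_in B w.
Proof.
move=> ygen; rewrite chambers_in_generic // weyl_tessellationE.
have -> : [set p | open_chamber p (y w) !=set0] = [set` open_chambers (y w)].
  by apply/seteqP; split=> p /=; rewrite inE => H; apply/asboolP.
rewrite uniform_law_image; last first.
  by move=> p q; rewrite !inE => pp _; exact: (cone_inj pp).
by rewrite (card_open_chambers ygen).
Qed.

Lemma measurable_cone_event B :
  measurable [set t : tup | B (weyl_chamber_cone (tuple_vectors t))] ->
  measurable (cone_event B).
Proof. by move=> mB; apply: measurableI => //; exact: measurable_chamber_neq0. Qed.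

(** The number of cones is almost surely constant, so the normalisation can be
taken out of the expectation. *)
Lemma weyl_cone_law_conditional B :
  measurable [set t : tup | B (weyl_chamber_cone (tuple_vectors t))] ->
  weyl_cone_law P Y B =
  conditional_law P (fun w => weyl_chamber_cone (y w))
    [set w | weyl_chamber_cone (y w) <> [set 0]] B.
Proof.
move=> /measurable_cone_event mB; have [N [mN N0 Nsub]] := Ygen.
have gen w : ~ N w -> typeB_general_position (y w).
  by move=> Nw; apply: contrapT => H; apply: Nw; exact: Nsub.
have chambers_ge0 B' w : 0 <= chambers_in B' w by apply: sumr_ge0 => p _; rewrite indicE.
have uniform_ge0 w : 0 <= uniform_law R (weyl_tessellation (y w)) B.
  by rewrite /uniform_law mulr_ge0 // fsumr_ge0 // => C _; rewrite indicE.
(* the case of all cones: there are [ncones] of them almost surely *)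
have total : #|{: chamber n}|%:R * fine (P [set w | weyl_chamber_cone (y w) <> [set 0]])
    = ncones%:R.
  have mT : measurable (cone_event setT).
    by apply: measurable_cone_event; exact: measurableT.
  apply: EFin_inj; transitivity (\int[P]_w (chambers_in setT w)%:E)%E.
    rewrite integral_chambers_in //; congr (_ * fine (P _))%:E.
    by apply/seteqP; split=> w // [].
  rewrite (ge0_integral_eq_outside_null (g := cst ncones%:R%:E) mN N0).
  - rewrite integral_cst // -[RHS]mule1; congr (_ * _)%E; exact: probability_setT.
  - by move=> w; rewrite lee_fin.
  - by move=> w; rewrite lee_fin.
  - move=> w /gen ygen /=; rewrite chambers_in_generic //; congr EFin.
    rewrite (eq_bigr (fun=> 1)) => [|p _]; last by rewrite indicE in_setT.
    by rewrite sumr_const (card_open_chambers ygen).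
have mass : weyl_cone_law P Y B = (ncones%:R^-1 * (#|{: chamber n}|%:R *
    fine (P [set w | B (weyl_chamber_cone (y w)) /\
                     weyl_chamber_cone (y w) <> [set 0]])))%:E.
  rewrite /weyl_cone_law.
  rewrite (ge0_integral_eq_outside_null (g := fun w =>
    (ncones%:R^-1%:E * (chambers_in B w)%:E)%E) mN N0); last 3 first.
  - by move=> w; rewrite lee_fin; exact: uniform_ge0.
  - by move=> w; rewrite lee_fin mulr_ge0.
  - by move=> w /gen ygen; rewrite (uniform_law_generic B ygen).
  rewrite ge0_integralZl_EFin //; first by rewrite integral_chambers_in.
    by move=> w _; rewrite lee_fin.
  apply/measurable_EFinP; apply: measurable_sum => p.
  by apply: measurableT_comp (measurable_chamber_tuple p); exact: measurable_indic.
rewrite mass /conditional_law; congr EFin.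
have M0 : #|{: chamber n}|%:R != 0 :> R.
  by rewrite pnatr_eq0 -lt0n; apply/card_gt0P; exists ([ffun=> false], 1%g).
have ratio (M c a b : R) : M != 0 -> M * b = c -> c^-1 * (M * a) = a / b.
  by move=> Mn0 <-; rewrite invfM mulrACA mulVf // mul1r mulrC.
exact: ratio M0 total.
Qed.

End random_weyl_cones.

Theorem proposition1p14 (disp : measure_display) (T : measurableType disp)
    (R : realType) (P : probability T R) (d n : nat)
    (Y : 'I_n -> {RV P >-> euclidean_space R d}) :
  (2 <= d)%N ->
  symmetrically_exchangeable P Y ->
  {ae P, forall w, typeB_general_position (fun i => Y i w : 'rV[R]_d)} ->
  let G := fun w => weyl_chamber_cone (fun i => Y i w : 'rV[R]_d) in
  same_distribution (weyl_cone_law P Y)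
    (conditional_law P G [set w | G w <> [set 0]]) /\
  same_distribution (dual_weyl_cone_law P Y) (law_of_dual (weyl_cone_law P Y)).
Proof.
move=> /ltnW d_gt0 Yexch Ygen G.
have lawE := weyl_cone_law_conditional Yexch d_gt0 Ygen.
split=> B BB; first by apply: lawE; exact: measurable_chamber_cone.
pose B' := [set C : set 'rV[R]_d | polyhedral_cone C /\ B (dual_cone C)].
have B'E (y : 'I_n -> 'rV[R]_d) :
    B' (weyl_chamber_cone y) = B (pos_hull (successive_differences y)).
  rewrite /B' /= dual_weyl_chamber_cone; apply/propext; split=> [[]//|By].
  by split=> //; exact: weyl_chamber_cone_polyhedral.
rewrite /law_of_dual (lawE B'); last first.
  have := measurable_pos_hull (n := n) BB; congr measurable.
  by apply/funext => t; rewrite /= B'E.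
rewrite /dual_weyl_cone_law /conditional_law.
have -> : [set w | pos_hull (successive_differences (fun i => Y i w : 'rV[R]_d)) <> setT]
    = [set w | G w <> [set 0]].
  by apply/funext => w; apply/propext; rewrite /= pos_hull_eqT.
rewrite (_ : _ @^-1` B = G @^-1` B') //.
by apply/funext => w; rewrite /= /preimage /= B'E.
Qed.
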